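(* Let $L$ be a geometric lattice of rank $r+1$ with $n$ atoms, and let $P$ be the rank $r+1$ near pencil on $n$ atoms. Then $h_S(L)\ge h_S(P)$ for all $S\subseteq[r]$.
   Context: A geometric lattice is a finite graded atomic lattice whose rank function $\rho$ satisfies $\rho(x\vee y)+\rho(x\wedge y)\le \rho(x)+\rho(y)$. For $n\ge r+1$, the rank $r+1$ near pencil on $n$ atoms is the lattice of flats of the simple matroid on $n$ elements that is the direct sum of $r-1$ coloops and the uniform matroid $U_{2,n-r+1}$ (geometrically: $n-r+1$ points on a line together with $r-1$ further points in general position). For a graded poset $P$ of rank $r+1$ with $\hat 0,\hat 1$ and $S\subseteq[r]$, $f_S(P)$ is the number of chains in $P$ whose elements have ranks exactly the elements of $S$, and $h_S(P)=\sum_{T\subseteq S}(-1)^{|S|-|T|}f_T(P)$. *)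

(* Defs.v *)
From HB Require Import structures.
From mathcomp Require Import all_boot all_order all_algebra.
Set Implicit Arguments. Unset Strict Implicit. Unset Printing Implicit Defensive.
Import Order.TTheory GRing.Theory Num.Theory.

Section Flags.
Variables (T : finType) (le : rel T) (rho : T -> nat).

Definition is_chain (C : {set T}) : bool :=
  [forall x in C, forall y in C, le x y || le y x].

Definition flag_f (k : nat) (S : {set 'I_k}) : nat :=
  #|[set C : {set T} | is_chain C &&
      [forall i : 'I_k, (i \in S) == [exists x in C, rho x == i]]]|.

Definition flag_h (k : nat) (S : {set 'I_k}) : int :=
  (\sum_(U : {set 'I_k} | U \subset S)
      (-1) ^+ (#|S| - #|U|) * ((flag_f U)%:Z))%R.
End Flags.

Section Geom.
Context {d : Order.disp_t} {T : finTBLatticeType d}.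
Local Open Scope order_scope.

Definition covers (x y : T) : bool :=
  (x < y) && [forall z, ~~ ((x < z) && (z < y))].

Definition is_rank_function (rho : T -> nat) : Prop :=
  rho \bot = 0%N /\ forall x y, covers x y -> rho y = (rho x).+1.

Definition is_atom (a : T) : bool := covers \bot a.

Definition atomic : Prop :=
  forall x : T, exists A : {set T},
    (forall a, a \in A -> is_atom a) /\ x = \join_(a in A) a.

Definition semimodular_rank (rho : T -> nat) : Prop :=
  forall x y : T, (rho (x `|` y) + rho (x `&` y) <= rho x + rho y)%N.

Definition geometric (rho : T -> nat) : Prop :=
  is_rank_function rho /\ atomic /\ semimodular_rank rho.

Definition atoms : {set T} := [set a | is_atom a].
End Geom.

Definition free_rank (m : nat) (A : {set 'I_m}) : nat := #|A|.
Definition unif_rank (k m : nat) (A : {set 'I_m}) : nat := minn k #|A|.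
Definition dsum_rank (a b : nat) (r1 : {set 'I_a} -> nat)
  (r2 : {set 'I_b} -> nat) (A : {set 'I_(a + b)}) : nat :=
  r1 [set i | lshift b i \in A] + r2 [set j | rshift a j \in A].

Definition is_flat (E : finType) (rk : {set E} -> nat) (A : {set E}) : bool :=
  [forall e, (e \notin A) ==> (rk A < rk (e |: A))].

(* the rank r+1 near pencil on n atoms: r-1 coloops (+) U_{2,n-r+1} *)
Definition np_ground (n r : nat) : nat := (r.-1 + (n - r).+1)%N.
Definition np_rank (n r : nat) : {set 'I_(np_ground n r)} -> nat :=
  dsum_rank (@free_rank r.-1) (@unif_rank 2 (n - r).+1).
Definition np_flat (n r : nat) : pred {set 'I_(np_ground n r)} :=
  fun A => is_flat (@np_rank n r) A.
Definition NearPencil (n r : nat) : finType := {A : {set 'I_(np_ground n r)} | @np_flat n r A}.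
Definition np_le (n r : nat) : rel (NearPencil n r) :=
  fun F G => (val F \subset val G).
Definition np_rho (n r : nat) (F : NearPencil n r) : nat := @np_rank n r (val F).

(* Main.v *)
(** Write nul[x,y] for the number of atoms of an interval minus its rank.  For
    the near pencil, [h_S = boolean_h S + nul * pencil_h S], where [boolean_h S]
    is the flag h-number of the Boolean lattice; the claim is that this is a lower
    bound for every interval of a geometric lattice.

    Fix an atom [a] of [[x,y]].  Splitting chains at the first element above [a]
    writes [h_S(x,y)] as a sum, without signs, of products
    [h_T(x,X) h_U(Y,y)] with [X] not above [a] and [Y = X \/ a] covering [X].
    Induction on the rank bounds both factors below by expressions that are affine
    in the nullities of [[x,X]] and [[Y,y]], so it remains to bound sums of products of
    nullities over the levels of [[x,y]].  With [N = nul[x,y] - nul[a,y]] one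
    needs: at least [1 + N] coatoms of [[x,y]] avoid [a] (a de Bruijn-Erdos
    inequality, by linear algebra); the sum of [1 + nul[x,X]] over these coatoms
    is at least [1 + nul[x,y]]; and the incidence graph between the coatoms and
    the elements of corank two avoiding [a] is connected.  Together they give
    weighted Dowling-Wilson inequalities that are sharp for near pencils. *)
Require Import Defs.
From mathcomp Require Import all_boot all_order all_algebra.
From mathcomp Require Import zify ring lra.
Import Order.TTheory GRing.Theory Num.Theory.
Set Implicit Arguments. Unset Strict Implicit. Unset Printing Implicit Defensive.
Local Open Scope ring_scope.

(** * Numerical recursions *)

(* bin_mi m j is 'C(m, j - i), with value 0 for j < i instead of the truncated 'C(m, 0). *)
Definition bin_m1 (m j : nat) : nat := if j is j'.+1 then 'C(m, j') else 0.
Definition bin_m2 (m j : nat) : nat := if j is j'.+2 then 'C(m, j') else 0.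
Definition bin_m3 (m j : nat) : nat := if j is j'.+3 then 'C(m, j') else 0.

(* Flag h-number of the Boolean lattice whose ranks run from x to y; here and
   below S is a decreasing list of ranks. *)
Fixpoint boolean_h (S : seq nat) (x y : nat) : int :=
  if S is s :: S' then
    'C(y - x, s - x)%:Z * boolean_h S' x s - boolean_h S' x y
  else 1.

(* Slope, in the nullity, of the flag h-number of the near pencils with ranks
   from x to y. *)
Fixpoint pencil_h (S : seq nat) (x y : nat) : int :=
  if S is s :: S' then
    (bin_m2 (y - x - 2) (s - x))%:Z * pencil_h S' x s
    + (bin_m1 (y - x - 2) (s - x))%:Z * boolean_h S' x s - pencil_h S' x y
  else 0.

(* All (k, T, U) with k = x or k in S, k + 1 not in S, and T, U the parts of S
   below k and above k + 1: k + 1 is where the smallest label of a maximal chain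
   with descent set S can occur. *)
Fixpoint terms (x : nat) (S : seq nat) : seq (nat * seq nat * seq nat) :=
  if S is s :: S' then
    (s, S', [::]) ::
      [seq (t.1, s :: t.2) | t <- [seq t <- terms x S' | t.1.1.+1 != s]]
  else [:: (x, [::], [::])].

Fixpoint ranks_in (S : seq nat) (x y : nat) : bool :=
  if S is s :: S' then [&& (x < s)%N, (s < y)%N & ranks_in S' x s] else true.

Lemma ranks_in_widen S x y y' : (y <= y')%N -> ranks_in S x y -> ranks_in S x y'.
Proof. by case: S => //= s S le /and3P[-> h ->]; rewrite (leq_trans h le). Qed.

Lemma terms_spec S x y t : (x < y)%N -> ranks_in S x y -> t \in terms x S ->
  [/\ (x <= t.1.1)%N, (t.1.1 < y)%N, ranks_in t.1.2 x t.1.1,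
      ranks_in t.2 t.1.1.+1 y & t.1.1.+1 = y -> t.2 = [::]].
Proof.
elim: S y t => [|s S IH] y t xy /=; first by move=> _; rewrite inE => /eqP ->.
case/and3P=> xs sy inS; rewrite inE => /orP[/eqP ->/=|]; first by rewrite ltnW.
case/mapP=> -[[k T] U]; rewrite mem_filter /= => /andP[/eqP ks].
case/(IH s _ xs inS) => /= h1 h2 h3 h4 h5 ->/=.
split=> //; [by lia | by rewrite sy h4 !andbT; lia | by lia].
Qed.

Lemma trinomial m s j : (j <= s)%N -> ('C(m, s) * 'C(s, j) = 'C(m, j) * 'C(m - j, s - j))%N.
Proof.
move=> js; case: (leqP s m) => sm; last first.
  rewrite (bin_small sm) mul0n; case: (leqP j m) => jm.
    by rewrite [X in (_ * X)%N]bin_small ?muln0 //; lia.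
  by rewrite (bin_small jm).
have jm := leq_trans js sm.
have e1 := bin_fact sm; have e2 := bin_fact js; have e3 := bin_fact jm.
have sjm : (s - j <= m - j)%N by lia.
have e4 := bin_fact sjm.
have e : (m - j - (s - j) = m - s)%N by lia.
rewrite e in e4.
apply/eqP; rewrite -(eqn_pmul2r (fact_gt0 j)) -(eqn_pmul2r (fact_gt0 (s - j))) -(eqn_pmul2r (fact_gt0 (m - s))).
apply/eqP.
transitivity (m`!).
  by rewrite -e1 -e2; ring.
by rewrite -e3 -e4; ring.
Qed.

Definition term_sum (S : seq nat) (x : nat) (F : nat -> seq nat -> seq nat -> int) :=
  \sum_(t <- terms x S) F t.1.1 t.1.2 t.2.

(** [terms] drops the terms with k + 1 = s. Their upper list is empty by [terms_spec], so the
    hypothesis makes [F] vanish on them and they may be put back. *)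
Lemma term_sum_cons s S x F :
  (forall k T, (k, T, [::]) \in terms x S -> k.+1 = s -> F k T [:: s] = 0) ->
  (x < s)%N -> ranks_in S x s ->
  term_sum (s :: S) x F = F s S [::] + term_sum S x (fun k T U => F k T (s :: U)).
Proof.
move=> F0 xs inS; rewrite /term_sum /= big_cons big_map big_filter /=; congr (_ + _).
rewrite [RHS](bigID (fun t => t.1.1.+1 != s)) /= [X in _ + X]big1_seq ?addr0 //.
move=> [[k T] U] /= /andP[/negPn/eqP ks tin].
have [_ _ _ _ /= h] := terms_spec xs inS tin.
by move: tin; rewrite (h ks) => tin; apply: F0.
Qed.

(** * Expansion of the two recursions along one atom *)

Lemma boolean_h_base s y : boolean_h [:: s] s y = 0.
Proof. by rewrite /= subnn bin0 mulr1 subrr. Qed.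

Lemma pencil_h_base s y : pencil_h [:: s] s y = 0.
Proof. by rewrite /= subnn /= !mul0r !subr0. Qed.

(** In a Boolean lattice ['C(y - x - 1, k - x)] elements X of rank k avoid a fixed atom a, and both
    [[x, X]] and [[X \/ a, y]] are again Boolean. *)
Lemma boolean_h_terms S x y : (x < y)%N -> ranks_in S x y ->
  boolean_h S x y = term_sum S x (fun k T U =>
    'C(y - x - 1, k - x)%:Z * boolean_h T x k * boolean_h U k.+1 y).
Proof.
elim: S y => [|s S IH] y xy.
  by move=> _; rewrite /term_sum /= big_seq1 /= subnn bin0.
move=> /= /and3P[xs sy inS].
rewrite term_sum_cons //; last first.
  by move=> k T _ ->; rewrite boolean_h_base mulr0.
(* Pascal: the elements of rank s avoiding the atom give the leading term, those above it give the
   rest. *)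
have -> : 'C(y - x, s - x) = ('C(y - x - 1, s - x) + 'C(y - x - 1, s - x - 1))%N.
  have -> : (y - x = (y - x - 1).+1)%N by lia.
  have -> : (s - x = (s - x - 1).+1)%N by lia.
  by rewrite binS !subn1 /=.
rewrite PoszD mulrDl -addrA; congr (_ + _); first by rewrite mulr1.
rewrite (IH y) ?(ranks_in_widen (ltnW sy)) // (IH s) //.
rewrite /term_sum mulr_sumr -sumrB; apply: eq_big_seq => t.
move=> /(terms_spec xs inS)[h1 h2 h3 h4 _] /=.
set k := t.1.1 in h1 h2 *.
have tri := @trinomial (y - x - 1) (s - x - 1) (k - x).
have {}tri : ('C(y - x - 1, s - x - 1) * 'C(s - x - 1, k - x) =
  'C(y - x - 1, k - x) * 'C(y - k.+1, s - k.+1))%N.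
  have <- : (y - x - 1 - (k - x) = y - k.+1)%N by lia.
  have <- : (s - x - 1 - (k - x) = s - k.+1)%N by lia.
  by apply: tri; lia.
by rewrite !mulrA -PoszM tri PoszM; ring.
Qed.

Lemma bin_m1_trinomial m i j : (j <= i)%N ->
  (bin_m2 m i.+1 * bin_m1 (i - 1) j = bin_m1 m j * 'C(m.+1 - j, i - j))%N.
Proof.
case: j => [|j]; first by rewrite muln0.
case: i => // i ji; rewrite !subSS subn0 /=; exact: trinomial.
Qed.

(** Expansion along an atom a of the long line. An X avoiding a contains at most one other point of
    that line, so [[x, X]] and [[X \/ a, y]] are Boolean; the nullity only affects the number of
    those X with one such point. *)
Lemma pencil_h_terms S x y : (x < y)%N -> ranks_in S x y ->
  pencil_h S x y = term_sum S x (fun k T U =>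
    (bin_m1 (y - x - 2) (k - x))%:Z * boolean_h T x k * boolean_h U k.+1 y).
Proof.
elim: S y => [|s S IH] y xy.
  by move=> _; rewrite /term_sum /= big_seq1 /= subnn /= !mul0r.
move=> /= /and3P[xs sy inS].
rewrite term_sum_cons //; last first.
  by move=> k T _ ->; rewrite boolean_h_base mulr0.
rewrite /= mulr1 addrAC addrC; congr (_ + _).
rewrite (IH y) ?(ranks_in_widen (ltnW sy)) // (IH s) //.
rewrite /term_sum mulr_sumr -sumrB; apply: eq_big_seq => t.
move=> /(terms_spec xs inS)[h1 h2 h3 h4 _] /=.
set k := t.1.1 in h1 h2 *.
have tri : (bin_m2 (y - x - 2) (s - x) * bin_m1 (s - x - 2) (k - x) =
  bin_m1 (y - x - 2) (k - x) * 'C(y - k.+1, s - k.+1))%N.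
  have := @bin_m1_trinomial (y - x - 2) (s - x - 1) (k - x).
  have -> : ((s - x - 1).+1 = s - x)%N by lia.
  have -> : (s - x - 1 - 1 = s - x - 2)%N by lia.
  have -> : ((y - x - 2).+1 - (k - x) = y - k.+1)%N by lia.
  have -> : (s - x - 1 - (k - x) = s - k.+1)%N by lia.
  by apply; lia.
by rewrite !mulrA -PoszM tri PoszM; ring.
Qed.

Lemma bin_m1S m j : bin_m1 m.+1 j = (bin_m1 m j + bin_m2 m j)%N.
Proof. by case: j => [|[|j]] //=; rewrite ?bin0 // binS. Qed.

Lemma bin_split m j : 'C(m.+1, j) = ('C(m, j) + bin_m1 m j)%N.
Proof. by case: j => [|j] /=; rewrite ?bin0 // binS. Qed.

Lemma bin_m2S m j : bin_m2 m.+1 j = (bin_m2 m j + bin_m3 m j)%N.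
Proof. by case: j => [|[|[|j]]] //=; rewrite ?bin0 // binS. Qed.

(* m = y - x - 3, i = s - x - 2, j = k - x in the proof of pencil_h_coloop. *)
Lemma coloop_coef_boolean m i j : (j <= i)%N ->
  (bin_m3 m i.+2 * bin_m1 (i - 1) j + bin_m2 m i.+2 * 'C(i.+1, j) =
   bin_m1 m j * 'C(m.+2 - j, i.+1 - j) + 'C(m, j) * 'C(m - j, i - j))%N.
Proof.
case: i => [|i] ji.
  by move: ji; rewrite leqn0 => /eqP ->; rewrite /= !subn0 !bin0.
rewrite bin_split /= subn1 /= mulnDr.
case: j ji => [|j] ji; first by rewrite /= !subn0 !bin0 !muln0 !mul1n !muln1 addn0.
rewrite /=; have t1 := @trinomial m i.+1 j.+1 ji.
have t2 := @trinomial m i.+1 j (leqW ji); have t3 := @trinomial m i j ji.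
case: (leqP j m) => jm; last first.
  rewrite (bin_small jm) (@bin_small m i.+1) ?(@bin_small m i) ?(@bin_small m j.+1) //; lia.
have -> : (m.+2 - j.+1 = (m - j).+1)%N by lia.
have -> : (i.+2 - j.+1 = (i - j).+1)%N by lia.
have e : (i.+1 - j = (i - j).+1)%N by lia.
by rewrite e in t2; rewrite binS -t1 !mulnDr -t2 -t3; lia.
Qed.

Lemma coloop_coef_pencil m i j : (j <= i)%N ->
  (bin_m3 m i.+2 * bin_m2 (i - 1) j = bin_m2 m j * 'C(m.+2 - j, i.+1 - j))%N.
Proof.
case: j => [|[|j]]; rewrite /= ?muln0 ?mul0n //.
case: i => // i ji; rewrite /= !subSS subn0; apply: trinomial; lia.
Qed.

(* The coefficients of [pencil_h] computed along a coloop instead of an atom of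
   the long line; truncated subtraction makes the case y = x + 2 correct. *)
Lemma pencil_h_coloop S x y : (x.+1 < y)%N -> ranks_in S x y ->
  pencil_h S x y = term_sum S x (fun k T U =>
    (bin_m1 (y - x - 3) (k - x))%:Z * boolean_h T x k * boolean_h U k.+1 y
    + (bin_m2 (y - x - 3) (k - x))%:Z * pencil_h T x k * boolean_h U k.+1 y
    + 'C(y - x - 3, k - x)%:Z * boolean_h T x k * pencil_h U k.+1 y).
Proof.
elim: S y => [|s S IH] y xy.
  by move=> _; rewrite /term_sum /= big_seq1 /= subnn /= !mul0r !mulr0.
move=> /= /and3P[xs sy inS].
rewrite term_sum_cons //; last first.
  by move=> k T _ ->; rewrite boolean_h_base pencil_h_base !mulr0.
have xs' : (y = x.+2)%N \/ (x.+2 < y)%N by lia.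
case: xs' => [yx|xy3].
  have sx : s = x.+1 by lia.
  have S0 : S = [::].
    by case: S inS {IH} => //= u S /and3P[h1 h2 _]; lia.
  rewrite S0 sx yx /term_sum /= !big_seq1 /=.
  have -> : (x.+2 - x - 2 = 0)%N by lia.
  have -> : (x.+2 - x - 3 = 0)%N by lia.
  have -> : (x.+1 - x = 1)%N by lia.
  have -> : (x.+2 - x.+1 = 1)%N by lia.
  by rewrite !subnn /= ?bin0 ?mulr0 ?mul0r; ring.
set m := (y - x - 3)%N.
have -> : (y - x - 2 = m.+1)%N by rewrite /m; lia.
rewrite bin_m2S bin_m1S !PoszD /= !mulr1 mulr0 addr0.
rewrite [RHS]addrAC.
(* One half of each Pascal split is the leading term of [term_sum_cons]; [H] is what remains. *)
have H : (bin_m3 m (s - x))%:Z * pencil_h S x s + (bin_m2 m (s - x))%:Z * boolean_h S x s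
   - pencil_h S x y = term_sum S x (fun k T U =>
    (bin_m1 m (k - x))%:Z * boolean_h T x k * boolean_h (s :: U) k.+1 y
    + (bin_m2 m (k - x))%:Z * pencil_h T x k * boolean_h (s :: U) k.+1 y
    + 'C(m, k - x)%:Z * boolean_h T x k * pencil_h (s :: U) k.+1 y).
  case: (ltnP x.+1 s) => xs2; last first.
    have sx : s = x.+1 by lia.
    have S0 : S = [::].
      by case: S inS {IH} => //= u S /and3P[h1 h2 _]; lia.
    rewrite S0 sx /term_sum /= !big_seq1 /=.
    have -> : (x.+1 - x = 1)%N by lia.
    by rewrite !subnn /= ?bin0 ?mulr0 ?mul0r; ring.
  rewrite (IH y) ?(ranks_in_widen (ltnW sy)) // (IH s) // (boolean_h_terms xs inS).
  rewrite /term_sum !mulr_sumr -big_split -sumrB; apply: eq_big_seq => t.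
  move=> /(terms_spec xs inS)[h1 h2 h3 h4 h5] /=.
  set k := t.1.1 in h1 h2 h5 *.
  rewrite -/m.
  (* Here k - x exceeds s - x - 2, outside the range of [coloop_coef_boolean], but the upper list is
     empty. *)
  case: (eqVneq k.+1 s) => [ks|/eqP ks].
    have [e1 e2 e3 e4] : [/\ (bin_m3 m (s - x) * bin_m1 (s - x - 3) (k - x) = 0)%N,
        (bin_m3 m (s - x) * bin_m2 (s - x - 3) (k - x) = bin_m2 m (k - x))%N,
        bin_m2 m (s - x) = bin_m1 m (k - x) & 'C(s - x - 1, k - x) = 1%N].
      have -> : (s - x = (k - x).+1)%N by lia.
      case: (k - x)%N => [|[|j]] //=; rewrite !subSS !subn0 !binn.
      by rewrite (@bin_small j) // muln0 muln1.
    rewrite (h5 ks) ks /= subnn bin0 /= e4 e3 [Posz (bin_m3 _ _) * _]mulrDr [Posz (bin_m3 _ _) * _]mulrDr.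
    by rewrite !mulrA -!PoszM e1 e2; ring.
  (* The coefficients of the products boolean-boolean, pencil-boolean and boolean-pencil are
     compared separately. *)
  have [e1 e2 e3] : [/\
    (bin_m3 m (s - x) * bin_m1 (s - x - 3) (k - x) + bin_m2 m (s - x) * 'C(s - x - 1, k - x) =
    bin_m1 m (k - x) * 'C(y - k.+1, s - k.+1) + 'C(m, k - x) * bin_m1 (y - k.+1 - 2) (s - k.+1))%N,
    (bin_m3 m (s - x) * bin_m2 (s - x - 3) (k - x) = bin_m2 m (k - x) * 'C(y - k.+1, s - k.+1))%N
    & (bin_m3 m (s - x) * 'C(s - x - 3, k - x) = 'C(m, k - x) * bin_m2 (y - k.+1 - 2) (s - k.+1))%N].
    have ji : (k - x <= s - x - 2)%N by lia.
    have -> : (y - k.+1 = m.+2 - (k - x))%N by rewrite /m; lia.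
    have -> : (s - k.+1 = (s - x - 2).+1 - (k - x))%N by lia.
    have -> : (s - x - 3 = (s - x - 2) - 1)%N by lia.
    have -> : (s - x - 1 = (s - x - 2).+1)%N by lia.
    have -> : (s - x = (s - x - 2).+2)%N by lia.
    move: ji; rewrite !subSS ?subn0; move: (s - x - 2)%N (k - x)%N => i j ji.
    have -> : (m.+2 - j - 2 = m - j)%N by lia.
    rewrite coloop_coef_boolean // coloop_coef_pencil //; split=> //.
      by have -> : (i.+1 - j = (i - j).+1)%N by lia.
    have -> : (i.+1 - j = (i - j).+1)%N by lia.
    case: i ji => [|i] ji; first by have -> : j = 0%N by [lia]; rewrite /= ?muln0.
    rewrite /= subSS subn0.
    case: (ltnP i j) => ij; first by have -> : j = i.+1 by [lia]; rewrite subnn (@bin_small i) /= ?muln0.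
    by rewrite subSn //=; apply: trinomial.
  have e1' : (bin_m3 m (s - x))%:Z * (bin_m1 (s - x - 3) (k - x))%:Z +
     (bin_m2 m (s - x))%:Z * 'C(s - x - 1, k - x)%:Z =
     (bin_m1 m (k - x))%:Z * 'C(y - k.+1, s - k.+1)%:Z +
     'C(m, k - x)%:Z * (bin_m1 (y - k.+1 - 2) (s - k.+1))%:Z by rewrite -!PoszM -!PoszD e1.
  move: e2 e3 => /(congr1 Posz) + /(congr1 Posz); rewrite !PoszM => e2 e3.
  move: (boolean_h t.1.2 x k) (boolean_h t.2 k.+1 s) (boolean_h t.2 k.+1 y)
     (pencil_h t.1.2 x k) (pencil_h t.2 k.+1 s) (pencil_h t.2 k.+1 y) => b b1 b2 p p1 p2.
  transitivity (((bin_m3 m (s - x))%:Z * (bin_m1 (s - x - 3) (k - x))%:Z +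
     (bin_m2 m (s - x))%:Z * 'C(s - x - 1, k - x)%:Z) * b * b1 +
     ((bin_m3 m (s - x))%:Z * (bin_m2 (s - x - 3) (k - x))%:Z) * p * b1 +
     ((bin_m3 m (s - x))%:Z * 'C(s - x - 3, k - x)%:Z) * b * p1 -
     ((bin_m1 m (k - x))%:Z * b * b2 + (bin_m2 m (k - x))%:Z * p * b2 + 'C(m, k - x)%:Z * b * p2)).
    by ring.
  by rewrite e1' e2 e3; ring.
by rewrite -H; ring.
Qed.

(** Termwise comparison of the two expansions: Pascal bounds each [bin_m1] by the matching binomial.
    The bounds make the weights in [interval_h_term_ge] nonnegative. *)
Lemma pencil_h_bounds S x y : ranks_in S x y -> 0 <= pencil_h S x y <= boolean_h S x y.
Proof.
have [n] := ubnP (y - x); elim: n S x y => // n IH S x y lt inS.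
case: (ltnP x y) => xy; last by case: S inS => //= s S /and3P[h1 h2 _]; lia.
rewrite pencil_h_terms // boolean_h_terms //.
have pos k T U : (x <= k < y)%N -> ranks_in T x k -> ranks_in U k.+1 y ->
    0 <= boolean_h T x k * boolean_h U k.+1 y.
  move=> /andP[xk ky] /IH h1 /IH h2; apply: mulr_ge0.
    by have := h1 _; case/(_ _)/andP; [lia | exact: le_trans].
  by have := h2 _; case/(_ _)/andP; [lia | exact: le_trans].
rewrite /term_sum !big_seq; apply/andP; split.
  apply: sumr_ge0 => t /(terms_spec xy inS)[h1 h2 h3 h4 _].
  by rewrite -mulrA mulr_ge0 // pos // h1.
apply: ler_sum => t /(terms_spec xy inS)[h1 h2 h3 h4 _].
rewrite -!mulrA ler_wpM2r // ?pos ?h1 //.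
have : (t.1.1 - x <= y - x - 1)%N by lia.
have -> : (y - x - 2 = y - x - 1 - 1)%N by lia.
case: (t.1.1 - x)%N => //= j.
by case: (y - x - 1)%N => // m _; rewrite binS subn1 /=; lia.
Qed.

(** * Intervals of a geometric lattice *)

(** The matrix of [f] has more rows than columns, hence a nonzero left kernel vector. *)
Lemma exists_dependency (P E : finType) (A : {set P}) (B : {set E}) (f : P -> E -> rat) :
  (#|B| < #|A|)%N ->
  exists2 c : P -> rat, (exists2 p, p \in A & c p != 0) &
    forall e, e \in B -> \sum_(p in A) c p * f p e = 0.
Proof.
move=> BA; pose M := \matrix_(i < #|A|, j < #|B|) f (enum_val i) (enum_val j).
have : kermx M != 0.
  by rewrite kermx_eq0 /row_free neq_ltn (leq_ltn_trans (rank_leq_col M)).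
case/rowV0Pn => v /sub_kermxP vM v0.
have [p0 p0A] : exists p, p \in A by apply/card_gt0P; lia.
exists (fun p => v 0 (enum_rank_in p0A p)).
  case/rV0Pn: v0 => i vi; exists (enum_val i); first exact: enum_valP.
  by rewrite enum_valK_in.
move=> e eB; rewrite big_enum_val /=.
have := congr1 (fun N : 'rV__ => N 0 (enum_rank_in eB e)) vM; rewrite !mxE => h; apply: etrans h.
by apply: eq_bigr => i _; rewrite mxE enum_valK_in enum_rankK_in.
Qed.

(** Flag h-number computed by removing the element of largest rank; [flag_h_seq] identifies it with
    [flag_h] when [D] is [predT]. Restricting [D] to the elements above x yields the interval
    [[x, y]]. *)
Fixpoint poset_h (T : finType) (le : rel T) (rho : T -> nat) (D : pred T) (S : seq nat) (y : T) : int :=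
  if S is s :: S' then
    \sum_(z | [&& D z, le z y & rho z == s]) poset_h le rho D S' z - poset_h le rho D S' y
  else 1.

Section Lattice.
Context {d : Order.disp_t} {T : finTBLatticeType d} (rho : T -> nat).
Implicit Types x y z a b X Y Z V : T.

Definition level x y k : {set T} := [set z | [&& (x <= z)%O, (z <= y)%O & rho z == k]].
Definition avoid x a y k : {set T} := [set z in level x y k | ~~ (a <= z)%O].
Definition rcover x a := (x <= a)%O && (rho a == (rho x).+1).
Definition natoms x y := #|level x y (rho x).+1|.
Definition nullity x y : int := (natoms x y)%:Z - (rho y)%:Z + (rho x)%:Z.
(* Excess over two points of the lines V of [x, y] through the atom a. *)
Definition thickness x a y : int :=
  \sum_(V in level a y (rho a).+1) ((natoms x V)%:Z - 2).

Hypothesis geom : geometric rho.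

(** * Rank, covers and joins with an atom *)

Lemma rho_lt x y : (x < y)%O -> (rho x < rho y)%N.
Proof.
have [[_ rhoS] _] := geom.
have [n] := ubnP #|[set z | (x < z)%O && (z <= y)%O]|; elim: n x y => // n IH x y lt xy.
pose P z := (x < z)%O && (z <= y)%O.
have Py : P y by rewrite /P xy lexx.
(* An element z with the fewest elements in [(x, z]] covers x. *)
case: (arg_minnP (fun z => #|[set t | (x < t)%O && (t <= z)%O]|) Py) => z /andP[xz zy] zmin.
have cz : covers x z.
  rewrite /covers xz; apply/forallP => t; apply/negP => /andP[xt tz].
  have := zmin t; rewrite /P xt (le_trans (ltW tz) zy) => /(_ isT).
  rewrite leqNgt => /negP; apply; apply: proper_card; apply/properP; split.
    by apply/subsetP => u; rewrite !inE => /andP[-> /le_trans->] //; apply: ltW.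
  by exists z; rewrite !inE ?xz ?lexx // lt_geF // andbF.
have := rhoS _ _ cz; have [->|zy'] := eqVneq z y; first by move->.
have {}zy' : (z < y)%O by rewrite lt_neqAle zy'.
suff : (rho z < rho y)%N by lia.
apply: IH => //; apply: leq_trans (_ : (_ < #|[set z0 | (x < z0)%O && (z0 <= y)%O]|)%N) _; last by lia.
apply: proper_card; apply/properP; split.
  by apply/subsetP => u; rewrite !inE => /andP[/(lt_trans xz)-> ->].
by exists z; rewrite !inE ?xz // ltxx.
Qed.

Lemma rho_le x y : (x <= y)%O -> (rho x <= rho y)%N.
Proof. by rewrite le_eqVlt => /orP[/eqP->//|/rho_lt/ltnW]. Qed.

Lemma rho_eq x y : (x <= y)%O -> (rho y <= rho x)%N -> x = y.
Proof. by rewrite le_eqVlt => /orP[/eqP->//|/rho_lt]; lia. Qed.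

(** The meet of X and a lies above x, so semimodularity lets the rank grow by at most one. *)
Lemma rho_join x a X : rcover x a -> (x <= X)%O -> ~~ (a <= X)%O ->
  rho (X `|` a)%O = (rho X).+1.
Proof.
have [_ [_ semi]] := geom.
move=> /andP[xa /eqP ra] xX aX; have := semi X a.
have : (rho x <= rho (X `&` a)%O)%N by apply: rho_le; rewrite lexI xX.
have : (X < X `|` a)%O by rewrite lt_neqAle leUl andbT eq_sym eq_joinl.
move/rho_lt; lia.
Qed.

Lemma rcover_bot e : is_atom e -> rcover \bot%O e.
Proof.
have [[rho0 rhoS] _] := geom.
by move=> /rhoS h; rewrite /rcover le0x rho0 h rho0.
Qed.

(** Intervals inherit atomicity: an atom e of the lattice below y but not below w gives the cover
    [x \/ e] of x. *)
Lemma cover_separates x y w : (x <= y)%O -> (x <= w)%O -> ~~ (y <= w)%O ->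
  exists b, [/\ rcover x b, (b <= y)%O & ~~ (b <= w)%O].
Proof.
have [_ [atomic _]] := geom.
move=> xy xw yw; have [A [Aat yE]] := atomic y.
have [e eA ew] : exists2 e, e \in A & ~~ (e <= w)%O.
  apply/exists_inP; rewrite -negb_forall_in; apply: contra yw => /forall_inP h.
  by rewrite yE; apply/joinsP.
have ey : (e <= y)%O by rewrite yE; apply: joins_sup.
exists (x `|` e)%O; split.
- rewrite /rcover leUl (rho_join (rcover_bot (Aat _ eA))) ?le0x ?eqxx //.
  by apply: contra ew => ex; apply: le_trans ex xw.
- by rewrite leUx xy.
- by rewrite leUx xw.
Qed.

Lemma levelP x y k z : reflect [/\ (x <= z)%O, (z <= y)%O & rho z = k] (z \in level x y k).
Proof. by rewrite inE; apply: (iffP and3P) => -[-> -> /eqP]. Qed.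

Lemma avoidP x a y k z : reflect [/\ (x <= z)%O, (z <= y)%O, rho z = k & ~~ (a <= z)%O]
  (z \in avoid x a y k).
Proof.
rewrite inE; apply: (iffP andP) => [[/levelP[-> -> ->] ->] //|[h1 h2 h3 h4]].
by split=> //; apply/levelP.
Qed.

Lemma join_cover x a X Y : rcover x a -> (x <= X)%O -> ~~ (a <= X)%O ->
  (a <= Y)%O -> (X <= Y)%O -> rho Y = (rho X).+1 -> (X `|` a)%O = Y.
Proof. by move=> c xX aX aY XY r; apply: rho_eq; rewrite ?leUx ?aY ?XY // (rho_join c) ?r. Qed.

Lemma level_low x y : (x <= y)%O -> level x y (rho x) = [set x].
Proof.
move=> xy; apply/setP => z; rewrite !inE; apply/and3P/eqP => [[xz _ /eqP r]|->].
  by apply/esym/rho_eq; rewrite ?r.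
by rewrite lexx xy.
Qed.

Lemma sum_level x a y k (R : zmodType) (f : T -> R) : rcover x a -> (a <= y)%O ->
  \sum_(z in level x y k) f z = \sum_(z in level a y k) f z + \sum_(z in avoid x a y k) f z.
Proof.
move=> /andP[xa _] ay; rewrite (bigID (fun z => a <= z)%O) /=; congr (_ + _); apply: eq_bigl => z.
  rewrite !inE; case az: (a <= z)%O; last by rewrite andbF.
  by rewrite (le_trans xa az) andbT.
by rewrite !inE.
Qed.

(** The elements avoiding a are grouped by their join with a, of rank k + 1 by [rho_join]. *)
Lemma sum_avoid x a y k (R : zmodType) (f : T -> R) : rcover x a -> (a <= y)%O ->
  \sum_(z in avoid x a y k) f z =
  \sum_(Y in level a y k.+1) \sum_(z in avoid x a Y k) f z.
Proof.
move=> c ay; rewrite (partition_big (fun z => z `|` a)%O (fun Y => Y \in level a y k.+1)) /=.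
  apply: eq_bigr => Y /levelP[aY Yy rY]; apply: eq_bigl => z.
  apply/andP/avoidP => [[/avoidP[h1 h2 h3 h4] /eqP <-]|[h1 h2 h3 h4]].
    by rewrite leUl.
  split; first by apply/avoidP; rewrite (le_trans h2).
  by apply/eqP/(join_cover c); rewrite // h3.
move=> z /avoidP[h1 h2 h3 h4]; apply/levelP.
by rewrite leUr leUx h2 ay (rho_join c) // h3.
Qed.

(** * Atoms, lines and nullity of an interval *)

Lemma card_sumZ (A : {set T}) : (#|A|)%:Z = \sum_(z in A) (1 : int).
Proof. by rewrite sumr_const natz. Qed.

Lemma natoms_avoid x a y : rcover x a -> (a <= y)%O ->
  (natoms x y)%:Z = 1 + (#|avoid x a y (rho x).+1|)%:Z.
Proof.
move=> c ay; have /andP[xa /eqP ra] := c.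
by rewrite /natoms !card_sumZ (sum_level _ _ c ay) -ra level_low // big_set1.
Qed.

(** The lines through a are the atoms of [[a, y]] and partition the atoms other than a; a line
    contributes one such atom plus its excess over two points. *)
Lemma natomsE x a y : rcover x a -> (a <= y)%O ->
  (natoms x y)%:Z = 1 + (natoms a y)%:Z + thickness x a y.
Proof.
move=> c ay; have /andP[xa /eqP ra] := c.
rewrite (natoms_avoid c ay) card_sumZ (sum_avoid _ _ c ay) -addrA; congr (_ + _).
rewrite /thickness /natoms [X in X + _]card_sumZ -big_split /= ra; apply: eq_bigr => V /levelP[aV _ _].
by have := natoms_avoid c aV; rewrite /natoms -card_sumZ => ->; ring.
Qed.

Lemma nullityE x a y : rcover x a -> (a <= y)%O ->
  nullity x y = nullity a y + thickness x a y.
Proof.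
move=> c ay; rewrite /nullity (natomsE c ay); have /andP[_ /eqP ->] := c; lia.
Qed.

Lemma natoms_ge2 x a V : rcover x a -> rcover a V -> (2 <= natoms x V)%N.
Proof.
move=> c1 c2; have /andP[xa /eqP ra] := c1; have /andP[aV /eqP rV] := c2.
have [|b [/andP[xb rb] bV ba]] := @cover_separates x V a (le_trans xa aV) xa.
  by apply/negP => /rho_le; lia.
suff : (0 < #|avoid x a V (rho x).+1|)%N by have := natoms_avoid c1 aV; lia.
by apply/card_gt0P; exists b; apply/avoidP; split=> //; [exact/eqP | apply: contra ba => ab;
  rewrite (rho_eq ab) // ra (eqP rb)].
Qed.

Lemma thick_ge0 x a y V : rcover x a -> V \in level a y (rho a).+1 -> 0 <= (natoms x V)%:Z - 2.
Proof.
move=> c /levelP[h1 _ h2]; have := @natoms_ge2 x a V c; rewrite /rcover h1 h2 eqxx => /(_ isT); lia.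
Qed.

Lemma thickness_ge0 x a y : rcover x a -> 0 <= thickness x a y.
Proof. by move=> c; apply: sumr_ge0 => V; apply: thick_ge0. Qed.

Lemma nullity_xx x : nullity x x = 0.
Proof.
rewrite /nullity /natoms; suff -> : level x x (rho x).+1 = set0 by rewrite cards0; lia.
by apply/setP => z; rewrite !inE; apply/negP => /and3P[h1 h2 /eqP]; have := rho_le h2; lia.
Qed.

Lemma exists_rcover x y : (x <= y)%O -> x != y -> exists2 a, rcover x a & (a <= y)%O.
Proof.
move=> xy ne; have [|a [h1 h2 _]] := cover_separates xy (lexx x).
  by apply: contra ne => yx; rewrite eq_le xy.
by exists a.
Qed.

Lemma nullity_ge0 x y : (x <= y)%O -> 0 <= nullity x y.
Proof.
have [n] := ubnP (rho y - rho x); elim: n x => // n IH x lt xy.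
have [->|ne] := eqVneq x y; first by rewrite nullity_xx.
have [a c ay] := exists_rcover xy ne; rewrite (nullityE c ay).
apply: addr_ge0; last exact: thickness_ge0.
by apply: IH => //; have := rho_le ay; have /andP[_ /eqP] := c; lia.
Qed.

Lemma rcover_join x a b : rcover x a -> rcover x b -> a != b -> rcover b (b `|` a)%O.
Proof.
move=> ca cb ab; have /andP[xb /eqP rb] := cb; have /andP[xa /eqP ra] := ca.
rewrite /rcover leUl (rho_join ca) ?eqxx //.
by apply: contra ab => /rho_eq ->; rewrite // ra rb.
Qed.

(** Climb one cover at a time: a cover of Z not below [Z \/ a] still avoids a, since otherwise it
    would equal [Z \/ a]. *)
Lemma extend_avoid x a y Z k : rcover x a -> (a <= y)%O -> (x <= Z)%O -> (Z <= y)%O ->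
  ~~ (a <= Z)%O -> (rho Z <= k < rho y)%N ->
  exists2 X, X \in avoid x a y k & (Z <= X)%O.
Proof.
move=> c ay; have [n] := ubnP (k - rho Z); elim: n Z => // n IH Z lt xZ Zy aZ /andP[Zk ky].
have [kZ|kZ] := eqVneq (rho Z) k; first by exists Z => //; apply/avoidP.
have [|b [cb by_ bZ]] := @cover_separates Z y (Z `|` a)%O Zy (leUl _ _).
  by apply/negP => /rho_le; rewrite (rho_join c) //; lia.
have /andP[Zb /eqP rb] := cb.
have [X hX bX] : exists2 X, X \in avoid x a y k & (b <= X)%O.
  have ab : ~~ (a <= b)%O by apply: contra bZ => ab; rewrite (@join_cover x a Z b).
  by apply: IH (le_trans xZ Zb) by_ ab _; rewrite rb; lia.
by exists X; rewrite ?(le_trans Zb).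
Qed.

(** * Lower bound on the number of coatoms avoiding an atom *)

Lemma le_joinl Z Z' a : (Z <= Z')%O -> ((Z `|` a)%O <= Z')%O = (a <= Z')%O.
Proof. by move=> ZZ'; rewrite leUx ZZ'. Qed.

Lemma rcoverU x a Z : rcover x a -> (x <= Z)%O -> ~~ (a <= Z)%O -> rcover Z (Z `|` a)%O.
Proof. by move=> c xZ aZ; rewrite /rcover leUl (rho_join c) ?eqxx. Qed.

(** An atom p of [[x, y]] not below [Z \/ a] lies below exactly one cover of Z other than [Z \/ a]
    without lying below Z, namely below [Z \/ p]. *)
Lemma sum_star x a y Z (R : zmodType) (c : T -> R) : rcover x a -> (a <= y)%O ->
  (x <= Z)%O -> (Z <= y)%O -> ~~ (a <= Z)%O ->
  \sum_(Z' in avoid Z (Z `|` a)%O y (rho Z).+1)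
     (\sum_(p in avoid x a Z' (rho x).+1) c p - \sum_(p in avoid x a Z (rho x).+1) c p)
  = \sum_(p in avoid x a y (rho x).+1) c p - \sum_(p in avoid x a (Z `|` a)%O (rho x).+1) c p.
Proof.
move=> ca ay xZ Zy aZ; pose A Y := avoid x a Y (rho x).+1.
have sub Y Y' : (Y <= Y')%O -> \sum_(p in A Y') c p - \sum_(p in A Y) c p =
    \sum_(p in A Y' | ~~ (p <= Y)%O) c p.
  move=> YY'; rewrite [X in X - _](bigID (fun p => p <= Y)%O) /= addrAC.
  rewrite [X in X - _](eq_bigl (mem (A Y))) ?subrr ?add0r // => p.
  apply/andP/avoidP => [[/avoidP[h1 h2 h3 h4] h5]|[h1 h2 h3 h4]] //.
  by split=> //; apply/avoidP; rewrite (le_trans h2).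
have ZaY : ((Z `|` a)%O <= y)%O by rewrite leUx Zy.
rewrite (sub _ _ ZaY) [RHS](partition_big (fun p => Z `|` p)%O
  (fun Z' => Z' \in avoid Z (Z `|` a)%O y (rho Z).+1)) /=; last first.
  move=> p /andP[/avoidP[h1 h2 h3 h4] h5].
  have cp : rcover x p by rewrite /rcover h1 h3 eqxx.
  have pZ : ~~ (p <= Z)%O by apply: contra h5 => /le_trans ->; rewrite ?leUl.
  apply/avoidP; rewrite leUl leUx Zy h2 (rho_join cp) //; split=> //.
  apply: contra h5 => h; rewrite (@join_cover x a Z (Z `|` p)%O) ?leUl ?leUr // ?(rho_join cp) //.
  by apply: le_trans h; rewrite leUr.
apply: eq_bigr => Z' /avoidP[h1 h2 h3 h4]; rewrite (sub _ _ h1); apply: eq_bigl => p.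
apply/idP/idP => [/andP[/avoidP[p1 p2 p3 p4] p5]|/andP[/andP[/avoidP[p1 p2 p3 p4] p5] /eqP p6]];
  apply/andP.
  have cp : rcover x p by rewrite /rcover p1 p3 eqxx.
  have e : (Z `|` p)%O = Z' by apply: (join_cover cp).
  split; last by apply/eqP.
  apply/andP; split; first by apply/avoidP; rewrite (le_trans p2).
  apply: contra h4 => h.
  have -> : (Z `|` a)%O = Z'; last by [].
  by apply/esym/rho_eq; rewrite -?e ?leUx ?leUl ?h // (rho_join ca) // e h3.
split; first by apply/avoidP; rewrite -p6 leUr.
by apply: contra p5 => /le_trans ->; rewrite ?leUl.
Qed.

Section Radon.
Variables (x a y V0 : T) (c : T -> rat).
Hypotheses (ca : rcover x a) (ay : (a <= y)%O).
Let flat_sum Z := \sum_(p in avoid x a Z (rho x).+1) c p.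
Hypothesis coatom0 : forall X, X \in avoid x a y (rho y).-1 -> flat_sum X = 0.
Hypothesis line0 : forall V, V \in level a y (rho a).+1 -> V != V0 -> flat_sum V = 0.
Hypothesis V0y : V0 \in level a y (rho a).+1.
Hypothesis V0_ge0 : 0 <= flat_sum V0.

(** An element above a collects the atoms of its lines through a, and [V0] is the only line whose
    sum may be nonzero. *)
Lemma flat_sum_above Y : (a <= Y)%O -> (Y <= y)%O ->
  flat_sum Y = if (V0 <= Y)%O then flat_sum V0 else 0.
Proof.
move=> aY Yy; rewrite {1}/flat_sum (sum_avoid _ _ ca aY).
have ra : rho a = (rho x).+1 by have /andP[_ /eqP] := ca.
have line_sub V : V \in level a Y (rho a).+1 -> V \in level a y (rho a).+1.
  by move=> /levelP[h1 h2 h3]; apply/levelP; rewrite (le_trans h2).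
have /levelP[aV0 _ rV0] := V0y.
rewrite -{1}ra; case: ifP => V0Y.
  have V0in : V0 \in level a Y (rho a).+1 by apply/levelP.
  rewrite (bigD1 V0) //= [X in _ + X]big1 ?addr0 //.
  by move=> V /andP[/line_sub h1 h2]; apply: line0.
rewrite big1 // => V hV; apply: line0; first exact: line_sub.
by apply: contraFN V0Y => /eqP <-; have /levelP[] := hV.
Qed.

(** Descending induction from the coatoms. By [flat_sum_above] the value at y is at least that at
    [Z \/ a], so [sum_star] bounds |C| times the value at Z by the sum over the covers in [C], which
    is at most 0. *)
Lemma flat_sum_le0 Z : (x <= Z)%O -> (Z <= y)%O -> ~~ (a <= Z)%O -> (rho Z < rho y)%N ->
  flat_sum Z <= 0.
Proof.
have [n] := ubnP (rho y - rho Z); elim: n Z => // n IH Z lt xZ Zy aZ rZ.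
have [top|ntop] := eqVneq (rho Z) (rho y).-1.
  by rewrite coatom0 //; apply/avoidP.
pose C := avoid Z (Z `|` a)%O y (rho Z).+1.
have := sum_star c ca ay xZ Zy aZ; rewrite -/C -!/(flat_sum _) sumrB sumr_const => star.
have CP Z' : Z' \in C -> flat_sum Z' <= 0.
  move=> /avoidP[h1 h2 h3 h4];
  have aZ' : ~~ (a <= Z')%O by rewrite -(le_joinl _ h1).
  by apply: IH (le_trans xZ h1) h2 aZ' _; rewrite h3; clear -lt rZ ntop; lia.
have [Z' Z'C _] : exists2 Z', Z' \in C & (Z <= Z')%O.
  apply: (extend_avoid (rcoverU ca xZ aZ)); rewrite ?leUx ?Zy ?lexx ?aZ //.
  by rewrite leqnSn /=; lia.
have C0 : (0 < #|C|)%N by apply/card_gt0P; exists Z'.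
rewrite -(pmulrn_lle0 _ C0).
have aZy : ((Z `|` a)%O <= y)%O by rewrite leUx Zy.
have : flat_sum (Z `|` a)%O <= flat_sum y.
  rewrite (flat_sum_above (leUr _ _) aZy) (flat_sum_above ay (lexx y)).
  by have /levelP[_ -> _] := V0y; case: ifP.
have : \sum_(Z' in C) flat_sum Z' <= 0 by rewrite -oppr_ge0 -sumrN sumr_ge0 // => U /CP; rewrite oppr_ge0.
move: star; set s1 := \sum_(_ in C) _; set s2 := _ *+ _ => e h1 h2; lra.
Qed.

(** At rank one [flat_sum_le0] says that no weight is positive, while the line through a and p has a
    nonnegative sum. *)
Lemma dependency_trivial p : p \in avoid x a y (rho x).+1 -> c p = 0.
Proof.
have ra : rho a = (rho x).+1 by have /andP[_ /eqP] := ca.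
have /levelP[aV0 V0y' rV0] := V0y.
have rxy : (rho x).+1.+1 = rho V0 by rewrite rV0 ra.
have np q : q \in avoid x a y (rho x).+1 -> c q <= 0.
  move=> /avoidP[h1 h2 h3 h4].
  have -> : c q = flat_sum q.
    rewrite /flat_sum (_ : avoid _ _ _ _ = [set q]) ?big_set1 //.
    apply/setP => z; rewrite inE; apply/avoidP/eqP => [[k1 k2 k3 k4]|->].
      by apply: rho_eq; rewrite ?k3 ?h3.
    by rewrite lexx.
  by apply: flat_sum_le0 => //; have := rho_le V0y'; lia.
move=> hp; have /avoidP[h1 h2 h3 h4] := hp; set V := (p `|` a)%O.
have hV : V \in level a y (rho a).+1.
  by apply/levelP; rewrite leUr leUx h2 ay (rho_join ca) // h3 ra.
have pos : 0 <= flat_sum V by have [->|/(line0 hV) ->] := eqVneq V V0.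
have pV : p \in avoid x a V (rho x).+1 by apply/avoidP; rewrite leUl.
apply/eqP; rewrite eq_le np //=; apply: le_trans pos _.
rewrite /flat_sum (bigD1 p) //= gerDl -oppr_ge0 -sumrN; apply: sumr_ge0 => q /andP[hq _].
rewrite oppr_ge0 np //; have /avoidP[k1 k2 k3 k4] := hq; apply/avoidP; split=> //.
by apply: le_trans k2 _; have /levelP[] := hV.
Qed.
End Radon.

Lemma level_above y k : (rho y < k)%N -> forall x, level x y k = set0.
Proof.
move=> yk x; apply/setP => z; rewrite [in RHS]inE; apply/negP => /levelP[_ /rho_le h1 h2]; lia.
Qed.

(* Each linear dependency among the atoms other than a that kills all coatoms
   avoiding a and all but one line through a vanishes; now count equations. *)
Lemma hyperplanes_avoiding x a y : rcover x a -> (a <= y)%O ->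
  1 + thickness x a y <= (#|avoid x a y (rho y).-1|)%:Z.
Proof.
move=> ca ay; have /andP[xa /eqP ra] := ca.
have [ya|ya] := eqVneq a y.
  rewrite /thickness -ya level_above // big_set0 addr0.
  have [X hX _] : exists2 X, X \in avoid x a a (rho a).-1 & (x <= X)%O.
    apply: (extend_avoid ca); rewrite ?lexx ?ra /= ?leqnn //.
    by apply/negP => /rho_le; lia.
  by rewrite lez_nat; apply/card_gt0P; exists X.
have [V0 cV0 V0y] := exists_rcover ay ya.
have V0in : V0 \in level a y (rho a).+1.
  by have /andP[? /eqP ?] := cV0; apply/levelP.
rewrite leNgt; apply/negP => lt.
set W := avoid x a y (rho y).-1 in lt.
pose P := avoid x a y (rho x).+1; pose L := level a y (rho a).+1.
have cardP : (#|P|)%:Z = (#|L|)%:Z + thickness x a y.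
  by have := natoms_avoid ca ay; rewrite (natomsE ca ay) -/P /natoms -/L; lia.
(* Fewer equations than unknowns: [W] has at most [thickness x a y] elements and one line is left
   out of [L]. *)
have BP : (#|W :|: (L :\ V0)| < #|P|)%N.
  apply: leq_ltn_trans (leq_card_setU _ _) _.
  have := cardsD1 V0 L; rewrite V0in; lia.
have [c0 [p pP cp] dep] := exists_dependency (fun p Z : T => (p <= Z)%O%:R) BP.
have flat c Z : (Z <= y)%O ->
    \sum_(p in avoid x a Z (rho x).+1) c p = \sum_(p in P) c p * (p <= Z)%O%:R :> rat.
  move=> Zy; rewrite [RHS](bigID (fun p => p <= Z)%O) /= [X in _ + X]big1 ?addr0.
    apply: eq_big => [q|q /avoidP[_ -> _ _]]; last by rewrite mulr1.
    apply/avoidP/andP => [[h1 h2 h3 h4]|[/avoidP[h1 h2 h3 h4] h5]] //.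
    by split=> //; apply/avoidP; rewrite (le_trans h2).
  by move=> q /andP[_ /negbTE ->]; rewrite mulr0.
(* The sign making the sum over the exceptional line [V0] nonnegative. *)
pose e : rat := if 0 <= \sum_(p in avoid x a V0 (rho x).+1) c0 p then 1 else -1.
have e0 : e != 0 by rewrite /e; case: ifP.
pose c q := c0 q * e.
have dep' Z : Z \in W :|: (L :\ V0) -> \sum_(p in avoid x a Z (rho x).+1) c p = 0.
  move=> hZ; rewrite flat.
    have /(congr1 (fun r => r * e)) := dep _ hZ; rewrite mul0r mulr_suml => h.
    by apply: etrans h; apply: eq_bigr => q _; rewrite /c mulrAC.
  by move: hZ; rewrite in_setU in_setD1 => /orP[/avoidP[]|/andP[_ /levelP[]]].
suff : c p = 0 by apply/eqP; rewrite mulf_neq0.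
apply: (@dependency_trivial x a y V0) => //.
- by move=> X hX; apply: dep'; rewrite in_setU hX.
- by move=> V hV VV0; apply: dep'; rewrite in_setU in_setD1 VV0 hV orbT.
- rewrite /c -mulr_suml /e; case: (lerP 0 (\sum_(p in avoid x a V0 (rho x).+1) c0 p)) => h.
    by rewrite mulr1.
  by rewrite mulrN1 oppr_ge0 ltW.
Qed.

(** * Nullity sums over the coatoms avoiding an atom *)

Lemma line_meets_once x a V X b1 b2 : rcover x a -> rcover a V -> ~~ (a <= X)%O ->
  b1 \in avoid x a V (rho x).+1 -> b2 \in avoid x a V (rho x).+1 ->
  (b1 <= X)%O -> (b2 <= X)%O -> b1 = b2.
Proof.
move=> ca /andP[aV /eqP rV] aX /avoidP[h1 h2 h3 h4] /avoidP[k1 k2 k3 k4] b1X b2X.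
apply/eqP/negPn/negP => ne.
have c2 : rcover x b2 by rewrite /rcover k1 k3 eqxx.
have e : (b1 `|` b2)%O = V.
  apply: (join_cover c2) => //; last by rewrite rV h3; have /andP[_ /eqP ->] := ca.
  by apply: contra ne => le21; rewrite eq_sym (rho_eq le21) ?h3 ?k3.
by move/negP: aX; apply; apply: le_trans aV _; rewrite -e leUx b1X.
Qed.

(** Passage to [[b, y]], where the line [b \/ a] is an atom when a and b are distinct atoms of
    [[x, y]]: this is how the inductions restrict to the elements through b. *)
Lemma avoid_above x a b y k : rcover x b ->
  avoid b (b `|` a)%O y k = [set X in avoid x a y k | (b <= X)%O].
Proof.
move=> /andP[xb _]; apply/setP => X; rewrite inE; apply/avoidP/andP.
  move=> [h1 h2 h3 h4]; split=> //; apply/avoidP; rewrite (le_trans xb) //; split=> //.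
  by apply: contra h4 => aX; rewrite leUx h1.
move=> [/avoidP[h1 h2 h3 h4] h5]; split=> //.
by apply: contra h4; rewrite leUx => /andP[].
Qed.

Lemma sum_thickness x a y k :
  \sum_(Y in level a y k) thickness x a Y =
  \sum_(V in level a y (rho a).+1) ((natoms x V)%:Z - 2) * (#|level V y k|)%:Z.
Proof.
rewrite /thickness (exchange_big_dep (fun V => V \in level a y (rho a).+1)) /=; last first.
  by move=> Y V /levelP[h1 h2 h3] /levelP[k1 k2 k3]; apply/levelP; rewrite (le_trans k2).
apply: eq_bigr => V /levelP[h1 h2 h3]; rewrite (card_sumZ (level V y k)) mulr_sumr; apply: eq_big => [Y|Y _]; last by rewrite mulr1.
apply/andP/levelP => [[/levelP[k1 k2 k3] /levelP[l1 l2 l3]]|[k1 k2 k3]] //.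
by split; apply/levelP; rewrite // (le_trans h1).
Qed.

(** The premise is the inequality of [sum_nullity_avoid] in [[b, y]]. Passing from b down to x adds
    thicknesses, and each line W through b other than V lies below one of the coatoms, so only the
    excess of V can be lost. *)
Lemma sum_nullity_through x a b y : rcover x a -> rcover x b -> (a <= y)%O -> (b <= y)%O -> a != b ->
  1 + nullity b y <= \sum_(X in avoid b (b `|` a)%O y (rho y).-1) (1 + nullity b X) ->
  1 + nullity x y - ((natoms x (b `|` a)%O)%:Z - 2) <=
  \sum_(X in avoid b (b `|` a)%O y (rho y).-1) (1 + nullity x X).
Proof.
move=> ca cb ay by_ ab H; set V := (b `|` a)%O in H *; set A := avoid _ _ _ _ in H *.
have cV : rcover b V by exact: rcover_join ca cb ab.
have Vy : (V <= y)%O by rewrite leUx by_.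
have Vin : V \in level b y (rho b).+1.
  by have /andP[h /eqP h'] := cV; apply/levelP.
rewrite (nullityE cb by_).
have -> : \sum_(X in A) (1 + nullity x X) =
    \sum_(X in A) (1 + nullity b X) + \sum_(X in A) thickness x b X.
  rewrite -big_split; apply: eq_bigr => X /avoidP[h _ _ _] /=.
  by rewrite (nullityE cb h) addrA.
have : thickness x b y - ((natoms x V)%:Z - 2) <= \sum_(X in A) thickness x b X; last by lia.
rewrite {2}/thickness (exchange_big_dep (fun W => W \in level b y (rho b).+1)) /=; last first.
  by move=> X W /avoidP[h1 h2 h3 h4] /levelP[k1 k2 k3]; apply/levelP; rewrite (le_trans k2).
rewrite /thickness (bigD1 V) //= addrAC subrr add0r [leRHS](bigD1 V) //=.
apply: ler_wpDl; first by apply: sumr_ge0 => X _; apply: thick_ge0 Vin.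
apply: ler_sum => W /andP[Win WV]; have /levelP[bW Wy rW] := Win.
have rV : rho V = (rho b).+1 by have /andP[_ /eqP] := cV.
have VW : ~~ (V <= W)%O by apply: contra WV => VW; rewrite eq_sym (rho_eq VW) // rW rV.
have [|X XA WX] := @extend_avoid b V y W (rho y).-1 cV Vy bW Wy VW.
  suff : (rho W < rho y)%N by clear; case: (rho y) => //= k; rewrite ltnS leqnn andbT.
  rewrite ltnNge; apply: contra VW => h; have -> := rho_eq Wy h; exact: Vy.
rewrite (bigD1 X) /=; last by rewrite XA; apply/levelP.
rewrite ler_wpDr // sumr_ge0 // => X' _; exact: thick_ge0 Win.
Qed.

(** Let V be a line through a with m points. By induction in [[c, y]], the coatoms through a point c
    of V other than a contribute at least 1 + nul - (m - 2). No coatom avoiding a contains two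
    points of V, so the m - 1 contributions add up. *)
Lemma sum_nullity_avoid x a y : rcover x a -> (a <= y)%O ->
  1 + nullity x y <= \sum_(X in avoid x a y (rho y).-1) (1 + nullity x X).
Proof.
have [n] := ubnP (rho y - rho x); elim: n x a => // n IH x a lt ca ay.
have /andP[xa /eqP ra] := ca.
have [ya|ya] := eqVneq a y.
  have h := hyperplanes_avoiding ca ay.
  apply: le_trans (_ : _ <= \sum_(X in avoid x a y (rho y).-1) 1) _.
    by rewrite -card_sumZ (nullityE ca ay) {1}ya nullity_xx add0r.
  by apply: ler_sum => X /avoidP[h1 _ _ _]; rewrite lerDl nullity_ge0.
have [|b [cb by_ ba]] := @cover_separates x y a (le_trans xa ay) xa.
  by apply: contra ya => ya; rewrite eq_le ay.
have /andP[xb /eqP rb] := cb.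
have ab : a != b by apply: contra ba => /eqP ->.
pose V := (b `|` a)%O; set m := (natoms x V)%:Z.
have cV : rcover a V by rewrite /V joinC; rewrite (rcover_join cb ca) // eq_sym.
have [aV /eqP rV] := andP cV.
have Vy : (V <= y)%O by rewrite leUx by_.
pose F X := 1 + nullity x X; set A := avoid x a y (rho y).-1.
have F0 X : X \in A -> 0 <= F X.
  by move=> /avoidP[h _ _ _]; rewrite addr_ge0 // nullity_ge0.
have step c : c \in avoid x a V (rho x).+1 -> 1 + nullity x y - (m - 2) <= \sum_(X in A | (c <= X)%O) F X.
  move=> /avoidP[h1 h2 h3 h4].
  have cc : rcover x c by rewrite /rcover h1 h3 eqxx.
  have cy : (c <= y)%O := le_trans h2 Vy.

  have Vc : (c `|` a)%O = V by apply: (join_cover ca h1 h4 aV h2); rewrite rV ra h3.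
  have ac : a != c by apply: contra h4 => /eqP ->.
  have := @sum_nullity_through x a c y ca cc ay cy ac; rewrite Vc -/m -Vc (avoid_above a y _ cc) => st.
  rewrite (eq_bigl (fun X => X \in [set X in A | (c <= X)%O])); last by move=> X; rewrite [RHS]in_set.
  apply: st; rewrite -(avoid_above a y _ cc); apply: IH; rewrite ?leUx ?cy //; last exact: rcover_join ca cc ac.
  by have := rho_le cy; clear -lt h3; lia.
have f1 : m - 2 <= nullity x y.
  rewrite (nullityE ca ay); apply: ler_wpDl; first exact: nullity_ge0.
  rewrite /thickness (bigD1 V) /=; last by apply/levelP.
  by rewrite lerDl sumr_ge0 // => W /andP[h _]; apply: thick_ge0 h.
have tot : (1 + nullity x y - (m - 2)) * (m - 1) <= \sum_(X in A) F X.
  have -> : m - 1 = (#|avoid x a V (rho x).+1|)%:Z by rewrite /m (natoms_avoid ca aV); ring.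
  rewrite (card_sumZ (avoid _ _ _ _)) mulr_sumr.
  apply: le_trans (_ : _ <= \sum_(c in avoid x a V (rho x).+1) \sum_(X in A | (c <= X)%O) F X) _.
    by apply: ler_sum => c /step; rewrite mulr1.
  rewrite (exchange_big_dep (mem A)) /=; last by move=> c X _ /andP[].
  apply: ler_sum => X XA; rewrite XA.
  case: (pickP (fun c => (c \in avoid x a V (rho x).+1) && (c <= X)%O)) => [c /andP[hc cX]|none]; last first.
    by rewrite big_pred0 ?F0.
  rewrite (big_pred1 c) // => c'; apply/andP/eqP => [[h1 h2]|->] //.
  by have /avoidP[_ _ _ aX] := XA; apply: (line_meets_once ca cV aX).
(* With u the nullity and t = m - 2, the product is 1 + u + t (u - t), and t lies between 0 and
   u. *)
apply: le_trans tot; have := @natoms_ge2 x a V ca cV; rewrite -/m -lez_nat -/m => m2.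
by clear -f1 m2; clearbody m; move: (nullity x y) f1 => u f1; nia.
Qed.

(** * Connectivity between coatoms and elements of corank two *)

(** Take Y of maximal rank below X with b not below [Y \/ a]. If X did not cover Y, two covers e1,
    e2 of Y below X would have the same join [Y \/ a \/ b] with a; by rank [e1 \/ e2] would equal
    it, putting a below X. *)
Lemma coatom_below x a b y X : rcover x a -> rcover x b -> (a <= y)%O -> (b <= y)%O ->
  ~~ (b <= a)%O -> X \in avoid x a y (rho y).-1 ->
  exists Y, [/\ Y \in avoid x a y (rho y).-2, (Y <= X)%O & ~~ (b <= Y `|` a)%O].
Proof.
move=> ca cb ay by_ ba /avoidP[xX Xy rX aX].
have /andP[xa _] := ca.
pose P Y := [&& (x <= Y)%O, (Y <= X)%O & ~~ (b <= Y `|` a)%O].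
have Px : P x by rewrite /P lexx xX (join_idPr xa).
case: (arg_maxnP rho Px) => Y /and3P[xY YX bY] Ymax.
have aY : ~~ (a <= Y)%O by apply: contra aX => /le_trans ->.
have rXa : rho (X `|` a)%O = (rho X).+1 by apply: (rho_join ca).
have Xa : (X `|` a)%O = y.
  by apply: rho_eq; rewrite ?leUx ?Xy // rXa rX leqSpred.
have up e : (Y <= e)%O -> rho e = (rho Y).+1 -> (e <= X)%O -> (b <= e `|` a)%O.
  move=> Ye re eX; apply/negPn/negP => be.
  have Pe : P e by rewrite /P (le_trans xY Ye) eX be.
  by have := Ymax e Pe; rewrite /= re ltnn.
have YnX : ~~ (X <= Y)%O.
  by apply: contra bY => XY; rewrite (le_anti (introT andP (conj XY YX))) in Xa *; rewrite Xa.
have [e1 [c1 e1X _]] := cover_separates YX (lexx Y) YnX.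
have /andP[Ye1 /eqP re1] := c1.
exists Y; split=> //; apply/avoidP; split=> //; first exact: le_trans YX Xy.
suff : rho X = (rho Y).+1 by move=> h; rewrite -[RHS]/(rho y).-1.-1 -rX h.
have [Xe|Xe] := boolP (X <= e1)%O.
  by rewrite -re1; congr rho; apply/le_anti; rewrite Xe e1X.
have [e2 [c2 e2X e2e1]] := cover_separates YX Ye1 Xe.
have /andP[Ye2 /eqP re2] := c2.
have ae e : (Y <= e)%O -> rho e = (rho Y).+1 -> (e <= X)%O -> (e `|` a)%O = ((Y `|` a) `|` b)%O.
  move=> Ye re eX; apply/esym/rho_eq.
    by rewrite !leUx leUr (up e) // (le_trans Ye) ?leUl.
  have xe : (x <= e)%O := le_trans xY Ye.
  rewrite (rho_join ca xe) ?(rho_join cb) ?(rho_join ca) ?re //.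
    by apply: le_trans xY _; rewrite leUl.
  by apply: contra aX => /le_trans ->.
have eq12 : (e1 `|` a)%O = (e2 `|` a)%O by rewrite (ae e1) // (ae e2).
have e12X : ((e1 `|` e2)%O <= X)%O by rewrite leUx e1X.
have r12 : rho (e1 `|` e2)%O = (rho Y).+2 by rewrite (rho_join c2) // re1.
have e12 : (e1 `|` e2)%O = (e1 `|` a)%O.
  apply: rho_eq; first by rewrite leUx leUl eq12 leUl.
  rewrite r12 (rho_join ca) ?re1 //; first exact: le_trans xY Ye1.
  by apply: contra aX => /le_trans ->.
by move/negP: aX; case; apply: le_trans e12X; rewrite e12 leUr.
Qed.

Lemma natoms_above x a y Y : rcover x a -> (a <= y)%O -> Y \in avoid x a y (rho y).-2 ->
  (rho a < rho y)%N ->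
  (natoms Y y)%:Z = 1 + (#|[set X in avoid x a y (rho y).-1 | (Y <= X)%O]|)%:Z.
Proof.
move=> ca ay /avoidP[xY Yy rY aY] ray.
rewrite (natoms_avoid (rcoverU ca xY aY)) ?leUx ?Yy //; congr (1 + (#|pred_of_set _|)%:Z).
have /andP[_ /eqP ra] := ca.
have r1 : (rho Y).+1 = (rho y).-1 by rewrite rY; clear -ra ray; lia.
apply/setP => X; rewrite inE; apply/avoidP/andP.
  move=> [h1 h2 h3 h4]; split=> //; apply/avoidP; rewrite (le_trans xY) // h3 r1; split=> //.
  by apply: contra h4; rewrite leUx h1.
move=> [/avoidP[h1 h2 h3 h4] h5]; rewrite h3 r1; split=> //.
by apply: contra h4; rewrite leUx => /andP[].
Qed.

(** Counting form of connectivity: Y lies below [natoms Y y - 1] of the coatoms, so it saves at most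
    one component fewer. Induction in [[b, y]] treats the coatoms above b; any other coatom is
    linked to such a coatom [Y \/ b] by the Y of [coatom_below]. *)
Lemma avoid_connected x a y : rcover x a -> (rho a < rho y)%N -> (a <= y)%O ->
  (#|avoid x a y (rho y).-1|)%:Z - 1 <=
  \sum_(Y in avoid x a y (rho y).-2) ((natoms Y y)%:Z - 2).
Proof.
have [n] := ubnP (rho y - rho x); elim: n x a => // n IH x a lt ca ray ay.
have /andP[xa /eqP ra] := ca; have xy := le_trans xa ay.
have [|b [cb by_ ba]] := @cover_separates x y a xy xa.
  by apply/negP => /rho_le; rewrite leqNgt ray.
have /andP[xb /eqP rb] := cb.
have ab : a != b by apply: contra ba => /eqP ->.
have cV := rcover_join ca cb ab.
set A1 := avoid x a y (rho y).-1; set A2 := avoid x a y (rho y).-2.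
pose up Y := [set X in A1 | (Y <= X)%O].
have [ry|ry] := eqVneq (rho y) (rho a).+1.
  have r2 : (rho y).-2 = rho x by rewrite ry ra.
  have xA2 : x \in A2 by apply/avoidP; split=> //; apply/negP => /rho_le; rewrite ra ltnn.
  have -> : A2 = [set x].
    apply/setP => z; rewrite inE; apply/avoidP/eqP => [[h1 h2 h3 h4]|->]; last by case/avoidP: xA2.
    by apply/esym/rho_eq; rewrite ?h3 ?r2.
  rewrite big_set1 (natoms_above ca ay xA2 ray) -/A1.
  have -> : [set X in A1 | (x <= X)%O] = A1.
    apply/setP => X; rewrite in_set; case: (boolP (X \in A1)) => //= /avoidP[->] //.
  by set u := #|_|; clear; lia.
have {}ry : ((rho b).+1 < rho y)%N by rewrite rb -ra; clear -ry ray; lia.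
have Vy : ((b `|` a)%O <= y)%O by rewrite leUx by_.
have := IH b (b `|` a)%O; rewrite !(avoid_above a y _ cb) -/A1 -/A2 => /(_ _ cV _ Vy) H.
have {H} through : (#|[set X in A1 | (b <= X)%O]|)%:Z - 1 <=
    \sum_(Y in A2 | (b <= Y)%O) ((natoms Y y)%:Z - 2).
  rewrite (eq_bigl (fun Y => Y \in [set Y in A2 | (b <= Y)%O])); last by move=> Y; rewrite [RHS]in_set.
  apply: H; first by rewrite rb; clear -lt ra ray; lia.
  by have /andP[_ /eqP ->] := cV.
have rest : (#|[set X in A1 | ~~ (b <= X)%O]|)%:Z <=
    \sum_(Y in A2 | ~~ (b <= Y)%O) ((natoms Y y)%:Z - 2).
  apply: le_trans (_ : _ <= \sum_(Y in A2 | ~~ (b <= Y)%O)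
     \sum_(X in A1 | [&& (Y <= X)%O, ~~ (b <= X)%O & ~~ (b <= Y `|` a)%O]) 1) _.
    rewrite (exchange_big_dep (fun X => (X \in A1) && ~~ (b <= X)%O)) /=; last first.
      by move=> Y X _ /and4P[-> _ ->].
    rewrite card_sumZ [leLHS](eq_bigl (fun X => (X \in A1) && ~~ (b <= X)%O)); last by move=> X; rewrite [LHS]in_set.
    apply: ler_sum => X /andP[XA1 bX].
    have [Y [YA2 YX bY]] := coatom_below ca cb ay by_ ba XA1.
    rewrite (bigD1 Y) /=; first by rewrite lerDl sumr_ge0.
    rewrite YA2 XA1 YX bX bY !andbT /=; apply: contra bX => bY'; exact: le_trans bY' YX.
  apply: ler_sum => Y /andP[YA2 bY]; rewrite (natoms_above ca ay YA2 ray) -/A1.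
  have /avoidP[xY Yy rY aY] := YA2.
  have r1 : (rho Y).+1 = (rho y).-1 by rewrite rY; clear -ra ray; lia.
  have [X XA1 YX] : exists2 X, X \in A1 & (Y <= X)%O.
    by apply: (extend_avoid ca ay xY Yy aY); rewrite -r1 leqnSn r1; clear -ray; lia.
  have [bYa|bYa] := boolP (b <= Y `|` a)%O.
    rewrite big_pred0 => [|Z]; last by rewrite !andbF.
    have : (0 < #|[set X in A1 | (Y <= X)%O]|)%N by apply/card_gt0P; exists X; rewrite in_set XA1.
    by set u := #|_|; clear; lia.
  rewrite (eq_bigl (fun X => X \in [set X in A1 | (Y <= X)%O && ~~ (b <= X)%O])); last first.
    by move=> Z; rewrite andbT [RHS]in_set.
  rewrite -card_sumZ.
  (* [Y \/ b] is a coatom above both Y and b, so the coatoms above Y but not above b are at least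
     one fewer than all those above Y. *)
  have YbA : (Y `|` b)%O \in A1.
    apply/avoidP; split; first by apply: le_trans xY _; rewrite leUl.
    - by rewrite leUx Yy.
    - by rewrite (rho_join cb).
    - apply: contra bYa => aYb; rewrite (join_cover ca xY aY aYb) ?leUl ?leUr //.
      by rewrite (rho_join cb).
  have : ((Y `|` b)%O |: [set X in A1 | (Y <= X)%O && ~~ (b <= X)%O]) \subset [set X in A1 | (Y <= X)%O].
    apply/subsetP => Z /setU1P[->|/setIdP[Z1 /andP[Z2 _]]]; apply/setIdP => //.
    by rewrite YbA leUl.
  have nYb : (Y `|` b)%O \notin [set X in A1 | (Y <= X)%O && ~~ (b <= X)%O].
    by apply/negP => /setIdP[_ /andP[_]]; rewrite leUr.
  move/subset_leq_card; rewrite cardsU1 nYb.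
  by set u := #|_|; set v := #|_|; clear; lia.
have split1 : #|A1| = (#|[set X in A1 | (b <= X)%O]| + #|[set X in A1 | ~~ (b <= X)%O]|)%N.
  rewrite -(cardsID [set X | (b <= X)%O] A1); congr (_ + _)%N; apply: eq_card => X.
    by apply/setIP/setIdP; rewrite inE.
  by apply/setDP/setIdP; rewrite inE.
rewrite [leRHS](bigID (fun X => b <= X)%O) /= split1 PoszD.
by move: through rest; lra.
Qed.

Lemma sum_thickness_pairs x a y : rcover x a -> (rho a < rho y)%N -> (a <= y)%O ->
  thickness x a y <= \sum_(Y in avoid x a y (rho y).-2) ((natoms Y y)%:Z - 2).
Proof.
move=> ca ray ay; apply: le_trans (avoid_connected ca ray ay).
by have := hyperplanes_avoiding ca ay; lra.
Qed.

(** * Weighted Dowling-Wilson inequalities *)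

(** One statement for [hyperplanes_avoiding] ([al] false) and [sum_nullity_avoid] ([al] true), so
    that both can be fed into the same induction. *)
Lemma sum_weighted_avoid (al : bool) x a y : rcover x a -> (a <= y)%O ->
  1 + al%:Z * nullity a y + thickness x a y <=
  \sum_(X in avoid x a y (rho y).-1) (1 + al%:Z * nullity x X).
Proof.
move=> ca ay; case: al.
  have := sum_nullity_avoid ca ay; rewrite (nullityE ca ay) mul1r addrA => /le_trans; apply.
  by apply: ler_sum => X _; rewrite mul1r.
have := hyperplanes_avoiding ca ay; rewrite mul0r addr0 card_sumZ => /le_trans; apply.
by apply: ler_sum => X _; rewrite mul0r addr0.
Qed.

Lemma nullity_rcover a y : rcover a y -> nullity a y = 0.
Proof.
move=> ca; have /andP[ay /eqP ra] := ca; rewrite (nullityE ca) // nullity_xx add0r.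
by rewrite /thickness level_above // big_set0.
Qed.

Lemma sum_thickness_ge x a y (k c : nat) : rcover x a ->
  (forall V, V \in level a y (rho a).+1 -> (c <= #|level V y k|)%N) ->
  thickness x a y * c%:Z <= \sum_(Y in level a y k) thickness x a Y.
Proof.
move=> ca cl; rewrite sum_thickness /thickness mulr_suml; apply: ler_sum => V hV.
by rewrite ler_wpM2l ?(thick_ge0 ca hV) // lez_nat cl.
Qed.

(* Dowling-Wilson bound on the level j, weighted by the nullities of the lower
   (al) and upper (ga) intervals; the near pencil attains equality. *)
Lemma level_weighted (al ga : bool) j x y : (x <= y)%O ->
  'C(rho y - rho x, j)%:Z + nullity x y *
    ((bin_m1 (rho y - rho x - 2) j)%:Z + al%:Z * (bin_m2 (rho y - rho x - 2) j)%:Z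
     + ga%:Z * 'C(rho y - rho x - 2, j)%:Z)
  <= \sum_(Y in level x y (rho x + j)%N) (1 + al%:Z * nullity x Y) * (1 + ga%:Z * nullity Y y).
Proof.
have [n] := ubnP (rho y - rho x); elim: n al ga j x => // n IH al ga j x lt xy.
case: j => [|j].
  rewrite addn0 level_low // big_set1 nullity_xx mulr0 addr0 !bin0 /=.
  by rewrite le_eqVlt; apply/orP; left; apply/eqP; ring.
have [<-|ne] := eqVneq x y.
  by rewrite level_above ?big_set0 ?nullity_xx ?subnn ?mul0r //; lia.
have [a ca ay] := exists_rcover xy ne; have /andP[xa /eqP ra] := ca.
have rle := rho_le ay.
(* The unweighted case of the induction hypothesis bounds the level sizes of [[V, y]]. *)
have ncard V i k : (a <= V)%O -> (V <= y)%O -> k = (rho V + i)%N -> ('C(rho y - rho V, i) <= #|level V y k|)%N.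
  move=> aV Vy ->; rewrite -lez_nat.
  have ltV : (rho y - rho V < n)%N by have := rho_le aV; clear -lt ra rle; lia.
  have := @IH false false i V ltV Vy; rewrite !mul0r !addr0 => H.
  rewrite (eq_bigr (fun=> 1)) in H; last by move=> Y _; rewrite !mul0r !addr0 mulr1.
  rewrite -card_sumZ in H; apply: le_trans H; rewrite lerDl mulr_ge0 //; exact: nullity_ge0.
have thick k c : (forall V, V \in level a y (rho a).+1 -> (c <= #|level V y k|)%N) ->
   thickness x a y * c%:Z <= \sum_(Y in level a y k) thickness x a Y by exact: sum_thickness_ge.
pose R := (rho y - rho x)%N.
have RV V : V \in level a y (rho a).+1 -> (rho y - rho V = R - 2)%N.
  by move=> /levelP[_ _ ->]; rewrite /R ra; clear; lia.
rewrite (sum_level _ _ ca ay).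
have ge1 (e : bool) u v : (u <= v)%O -> 1 <= 1 + e%:Z * nullity u v.
  by move=> uv; rewrite lerDl mulr_ge0 // nullity_ge0.
have e1 : (rho x + j.+1 = rho a + j)%N by rewrite ra addSnnS.
have e2 : ((rho x + j.+1).+1 = rho a + j.+1)%N by rewrite ra addSn.
(* Elements above a: [nullityE] replaces the nullity over x by that over a, plus a thickness. *)
have above : \sum_(Y in level a y (rho a + j)%N) (1 + al%:Z * nullity a Y) * (1 + ga%:Z * nullity Y y)
    + al%:Z * (thickness x a y * (bin_m2 (R - 2) j.+1)%:Z) <=
    \sum_(Y in level a y (rho x + j.+1)%N) (1 + al%:Z * nullity x Y) * (1 + ga%:Z * nullity Y y).
  rewrite -e1; apply: le_trans (_ : _ <= \sum_(Y in level a y (rho x + j.+1)%N)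
     ((1 + al%:Z * nullity a Y) * (1 + ga%:Z * nullity Y y) + al%:Z * thickness x a Y)) _.
    rewrite big_split lerD2l -mulr_sumr ler_wpM2l //; apply: thick => V hV.
    have /levelP[aV Vy rV] := hV; rewrite e1 -(RV V hV).
    by case: (j) => [|i] //=; apply: ncard => //; rewrite rV addSnnS.
  apply: ler_sum => Y /levelP[aY Yy _]; rewrite (nullityE ca aY) [_ * (nullity _ _ + _)]mulrDr addrA [leRHS]mulrDl lerD2l.
  by rewrite ler_peMr ?ge1 // mulr_ge0 // thickness_ge0.
(* Elements avoiding a are grouped by Z = [Y \/ a], with [sum_weighted_avoid] applied in each
   [[x, Z]]. *)
have below1 : \sum_(Y in level a y (rho a + j.+1)%N) (1 + al%:Z * nullity a Y) * (1 + ga%:Z * nullity Y y)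
    + thickness x a y * 'C(R - 2, j)%:Z <=
    \sum_(Y in avoid x a y (rho x + j.+1)%N) (1 + al%:Z * nullity x Y) * (1 + ga%:Z * nullity (Y `|` a)%O y).
  rewrite (sum_avoid _ _ ca ay) e2.
  apply: le_trans (_ : _ <= \sum_(Z in level a y (rho a + j.+1)%N)
     ((1 + al%:Z * nullity a Z) * (1 + ga%:Z * nullity Z y) + thickness x a Z)) _.
    rewrite big_split lerD2l; apply: thick => V hV.
    have /levelP[aV Vy rV] := hV; rewrite -(RV V hV).
    by apply: ncard => //; rewrite rV addSnnS.
  apply: ler_sum => Z /levelP[aZ Zy rZ].
  have rZ1 : (rho Z).-1 = (rho x + j.+1)%N by rewrite rZ -e2.
  apply: le_trans (_ : _ <= (\sum_(Y in avoid x a Z (rho x + j.+1)%N) (1 + al%:Z * nullity x Y)) * (1 + ga%:Z * nullity Z y)) _.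
    have := @sum_weighted_avoid al x a Z ca aZ; rewrite rZ1 => H.
    apply: le_trans (_ : _ <= (1 + al%:Z * nullity a Z + thickness x a Z) * (1 + ga%:Z * nullity Z y)) _.
      by rewrite [leRHS]mulrDl lerD2l ler_peMr ?ge1 ?thickness_ge0.
    by rewrite ler_wpM2r // (le_trans _ (ge1 _ _ _ Zy)).
  rewrite mulr_suml; apply: ler_sum => Y /avoidP[xY YZ rY aY].
  by rewrite (join_cover ca xY aY aZ YZ) // rY rZ -e2.
(* The surplus of [nullity Y y] over the nullity above [Y \/ a] is a thickness; grouping by the
   covers V of [Y \/ a] brings in [sum_thickness_pairs] in each [[x, V]]. *)
have below2 : ga%:Z * (thickness x a y * 'C(R - 2, j.+1)%:Z) <=
    ga%:Z * \sum_(Y in avoid x a y (rho x + j.+1)%N) thickness Y (Y `|` a)%O y.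
  rewrite ler_wpM2l //.
  apply: le_trans (_ : _ <= \sum_(V in level a y (rho a + j.+2)%N) thickness x a V) _.
    apply: thick => V hV; have /levelP[aV Vy rV] := hV; rewrite -(RV V hV).
    by apply: ncard => //; rewrite rV addSnnS.
  rewrite [in leRHS]/thickness [leRHS](exchange_big_dep (fun V => V \in level a y (rho a + j.+2)%N)) /=; last first.
    move=> Y V /avoidP[xY Yy rY aY] /levelP[YV Vy rV]; apply/levelP; split=> //.
      by apply: le_trans YV; rewrite leUr.
    by rewrite rV (rho_join ca) // rY e2 !addnS.
  apply: ler_sum => V /levelP[aV Vy rV].
  apply: le_trans (sum_thickness_pairs ca _ aV) _.
    by rewrite rV -[X in (X < _)%N]addn0 ltn_add2l.
  have -> : (rho V).-2 = (rho x + j.+1)%N by rewrite rV addnS -e2.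
  rewrite le_eqVlt; apply/orP; left; apply/eqP; apply: eq_bigl => Y.
  apply/avoidP/andP => [[xY YV rY aY]|[/avoidP[xY Yy rY aY] /levelP[YV _ _]]].
    split; first by apply/avoidP; rewrite (le_trans YV).
    by apply/levelP; rewrite leUx YV aV Vy (rho_join ca) // rY rV e2 !addnS.
  by split=> //; apply: le_trans YV; rewrite leUl.
have below : \sum_(Y in avoid x a y (rho x + j.+1)%N) (1 + al%:Z * nullity x Y) * (1 + ga%:Z * nullity (Y `|` a)%O y)
    + ga%:Z * \sum_(Y in avoid x a y (rho x + j.+1)%N) thickness Y (Y `|` a)%O y <=
    \sum_(Y in avoid x a y (rho x + j.+1)%N) (1 + al%:Z * nullity x Y) * (1 + ga%:Z * nullity Y y).
  rewrite mulr_sumr -big_split; apply: ler_sum => Y /avoidP[xY Yy rY aY] /=.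
  have cY := rcoverU ca xY aY; have aYy : ((Y `|` a)%O <= y)%O by rewrite leUx Yy.
  rewrite (nullityE cY aYy) [_ * (nullity _ _ + _)]mulrDr [1 + (_ + _)]addrA [leRHS]mulrDr lerD2l.
  by rewrite ler_peMl ?ge1 // mulr_ge0 // thickness_ge0.
have lt' : (rho y - rho a < n)%N by clear -lt ra rle; lia.
have := IH al ga j a lt' ay; have := IH al ga j.+1 a lt' ay.
move: above below1 below2 below.
have -> : (rho y - rho a = R - 1)%N by rewrite /R ra; clear; lia.
rewrite (nullityE ca ay) -/R.
have pascal : 'C(R, j.+1) = ('C(R - 1, j) + 'C(R - 1, j.+1))%N.
  have : (0 < R)%N by rewrite /R; clear -ra rle; lia.
  by case: (R) => // q _; rewrite binS subSS subn0 addnC.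
(* Pascal for all three coefficients. It can fail for R at most 2 because of truncated subtraction,
   but then [[a, y]] has rank at most one and nullity 0. *)
have step : nullity a y * ((bin_m1 (R - 2) j.+1)%:Z + al%:Z * (bin_m2 (R - 2) j.+1)%:Z + ga%:Z * 'C(R - 2, j.+1)%:Z) =
    nullity a y * ((bin_m1 (R - 1 - 2) j)%:Z + al%:Z * (bin_m2 (R - 1 - 2) j)%:Z + ga%:Z * 'C(R - 1 - 2, j)%:Z) +
    nullity a y * ((bin_m1 (R - 1 - 2) j.+1)%:Z + al%:Z * (bin_m2 (R - 1 - 2) j.+1)%:Z + ga%:Z * 'C(R - 1 - 2, j.+1)%:Z).
  have [R3|R3] := leqP R 2.
    suff -> : nullity a y = 0 by rewrite !mul0r.
    have [->|nay] := eqVneq a y; first exact: nullity_xx.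
    apply: nullity_rcover; rewrite /rcover ay; apply/eqP.
    have : (rho a < rho y)%N by apply: rho_lt; rewrite lt_neqAle nay.
    by move: R3; rewrite /R; clear -ra; lia.
  have -> : (R - 2 = (R - 1 - 2).+1)%N by clear -R3; lia.
  set m := (R - 1 - 2)%N.
  have -> : bin_m1 m.+1 j.+1 = (bin_m1 m j + bin_m1 m j.+1)%N by rewrite /= bin_split addnC.
  have -> : bin_m2 m.+1 j.+1 = (bin_m2 m j + bin_m2 m j.+1)%N by case: (j) => //= i; rewrite bin_split addnC; case: i.
  have -> : 'C(m.+1, j.+1) = ('C(m, j) + 'C(m, j.+1))%N by rewrite binS addnC.
  by rewrite !PoszD; ring.
rewrite pascal [(nullity a y + _) * _]mulrDl step PoszD /=.
set B1 := nullity a y * _; set B2 := nullity a y * _.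
move: (thickness x a y) => N.
set s1 := \sum_(_ in _) _; set s2 := \sum_(_ in _) _; set s3 := \sum_(_ in _) _; set s4 := \sum_(_ in _) _.
set s5 := \sum_(_ in _) _; set s6 := \sum_(_ in _) _ => h1 h2 h3 h4 h5 h6.
have -> : N * ('C(R - 2, j)%:Z + al%:Z * (bin_m2 (R - 2) j.+1)%:Z + ga%:Z * 'C(R - 2, j.+1)%:Z) =
   al%:Z * (N * (bin_m2 (R - 2) j.+1)%:Z) + N * 'C(R - 2, j)%:Z + ga%:Z * (N * 'C(R - 2, j.+1)%:Z) by ring.
move: h1 h2 h3 h4 h5 h6 => /=.
lra.
Qed.

(** * Lower bound for the flag h-numbers of intervals *)

Definition interval_h S x y := poset_h (fun u v : T => u <= v)%O rho (fun z => x <= z)%O S y.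

Lemma interval_h_cons s S x y :
  interval_h (s :: S) x y = \sum_(z in level x y s) interval_h S x z - interval_h S x y.
Proof. by rewrite /interval_h /=; congr (_ - _); apply: eq_bigl => z; rewrite inE. Qed.

Lemma avoid_low x a : rcover x a -> avoid x a a (rho x) = [set x].
Proof.
move=> /andP[xa /eqP ra]; apply/setP => z; rewrite inE; apply/avoidP/eqP => [[h1 h2 h3 h4]|->].
  by apply/esym/rho_eq; rewrite ?h3.
by split=> //; apply/negP => /rho_le; rewrite ra ltnn.
Qed.

(* Maximal chains of [x, y] are split at the first element above the atom a;
   taking a as the smallest label, k is the position just before a enters. *)
Lemma interval_h_terms S x a y : rcover x a -> (a <= y)%O -> ranks_in S (rho x) (rho y) ->
  interval_h S x y = term_sum S (rho x) (fun k A B =>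
    \sum_(Y in level a y k.+1) (\sum_(X in avoid x a Y k) interval_h A x X) * interval_h B Y y).
Proof.
move=> ca; have /andP[xa /eqP ra] := ca.
elim: S y => [|s S IH] y ay inS.
  by rewrite /term_sum /= big_seq1 /= -ra level_low // big_set1 avoid_low // big_set1.
have /and3P[xs sy inS'] : [&& (rho x < s)%N, (s < rho y)%N & ranks_in S (rho x) s] by [].
rewrite term_sum_cons //; last first.
  move=> k A _ ks; apply: big1 => Y /levelP[aY Yy rY].
  by rewrite interval_h_cons -ks -rY level_low // big_set1 subrr mulr0.
rewrite interval_h_cons (sum_level _ _ ca ay) (sum_avoid _ _ ca ay) addrAC addrC; congr (_ + _).
  by apply: eq_bigr => Y _; rewrite mulr1.
rewrite (IH y) ?(ranks_in_widen (ltnW sy)) //.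
rewrite (eq_bigr (fun z => term_sum S (rho x) (fun k A B =>
    \sum_(Y in level a z k.+1) (\sum_(X in avoid x a Y k) interval_h A x X) * interval_h B Y z))).
  rewrite /term_sum exchange_big -sumrB; apply: eq_bigr => t _ /=.
  rewrite (exchange_big_dep (fun Y => Y \in level a y t.1.1.+1)) /=; last first.
    by move=> z Y /levelP[h1 h2 h3] /levelP[k1 k2 k3]; apply/levelP; rewrite (le_trans k2).
  rewrite -sumrB; apply: eq_bigr => Y /levelP[aY Yy rY].
  (* For fixed Y, the sum over z of rank s minus the term at y is the recursion of the upper factor
     for [s :: t.2]. *)
  rewrite interval_h_cons mulrBr mulr_sumr; congr (_ - _); apply: eq_bigl => z.
  apply/andP/levelP => [[/levelP[h1 h2 h3] /levelP[k1 k2 k3]]|[h1 h2 h3]] //.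
  by split; apply/levelP; rewrite // (le_trans aY).
by move=> z /levelP[az zy rz]; apply: IH; rewrite // rz.
Qed.

Lemma card_level_ge V y i : (V <= y)%O -> ('C(rho y - rho V, i) <= #|level V y (rho V + i)%N|)%N.
Proof.
move=> Vy; rewrite -lez_nat.
have := @level_weighted false false i V y Vy; rewrite !mul0r !addr0.
rewrite (eq_bigr (fun=> 1)) -?card_sumZ => [|Y _]; last by rewrite !mul0r !addr0 mulr1.
by apply: le_trans; rewrite lerDl mulr_ge0 // nullity_ge0.
Qed.

(** The product of the two affine bounds is a combination of the four products
    [(1 + al nul)(1 + ga nul)] with weights built from [pT], [bT - pT], [pU] and [bU - pU], all
    nonnegative; [level_weighted] handles each. The thickness part is bounded separately. *)
Lemma interval_h_term_ge x a y k (bT pT bU pU : int) (q h : T -> int) :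
  rcover x a -> (a <= y)%O -> (rho x <= k)%N -> 0 <= pT <= bT -> 0 <= pU <= bU ->
  (forall Y, Y \in level a y k.+1 ->
     bT * (1 + thickness x a Y) + pT * nullity a Y <= q Y) ->
  (forall Y, Y \in level a y k.+1 -> bU + nullity Y y * pU <= h Y) ->
  'C(rho y - rho x - 1, k - rho x)%:Z * bT * bU
  + nullity a y *
     ((bin_m1 (rho y - rho x - 3) (k - rho x))%:Z * bT * bU
      + (bin_m2 (rho y - rho x - 3) (k - rho x))%:Z * pT * bU
      + 'C(rho y - rho x - 3, k - rho x)%:Z * bT * pU)
  + thickness x a y * ((bin_m1 (rho y - rho x - 2) (k - rho x))%:Z * bT * bU)
  <= \sum_(Y in level a y k.+1) q Y * h Y.
Proof.
move=> ca ay xk /andP[pT0 pTb] /andP[pU0 pUb] qP hP.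
have /andP[xa /eqP ra] := ca.
have bT0 := le_trans pT0 pTb; have bU0 := le_trans pU0 pUb.
set j := (k - rho x)%N.
have kE : k.+1 = (rho a + j)%N by rewrite ra /j; clear -xk; lia.
have {1}-> : (rho y - rho x - 1 = rho y - rho a)%N by rewrite ra; clear; lia.
have -> : (rho y - rho x - 3 = rho y - rho a - 2)%N by rewrite ra; clear; lia.
pose F (al ga : bool) := \sum_(Y in level a y k.+1) (1 + al%:Z * nullity a Y) * (1 + ga%:Z * nullity Y y).
have FP al ga := @level_weighted al ga j a y ay.
rewrite -kE in FP.
have thick : thickness x a y * (bin_m1 (rho y - rho x - 2) j)%:Z <= \sum_(Y in level a y k.+1) thickness x a Y.
  apply: sum_thickness_ge ca _ => V /levelP[aV Vy rV].
  case jE: j => [|i] //=; have := card_level_ge i Vy.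
  by rewrite rV kE jE ra addSnnS; have -> : (rho y - (rho x).+2 = rho y - rho x - 2)%N by clear; lia.
apply: le_trans (_ : _ <= \sum_(Y in level a y k.+1)
   ((bT + pT * nullity a Y) * (bU + nullity Y y * pU) + bT * bU * thickness x a Y)) _.
  rewrite big_split -mulr_sumr /=.
  have -> : \sum_(Y in level a y k.+1) (bT + pT * nullity a Y) * (bU + nullity Y y * pU) =
     (bT - pT) * (bU - pU) * F false false + pT * (bU - pU) * F true false +
     (bT - pT) * pU * F false true + pT * pU * F true true.
    rewrite /F !mulr_sumr -!big_split /=; apply: eq_bigr => Y _; ring.
  have := FP false false; have := FP true false; have := FP false true; have := FP true true.
  rewrite -!/(F _ _) /=.
  move: (F true true) (F true false) (F false true) (F false false) => F11 F10 F01 F00 h11 h01 h10 h00.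
  have d0 : 0 <= bT - pT by rewrite subr_ge0.
  have d1 : 0 <= bU - pU by rewrite subr_ge0.
  have := lerD (lerD (lerD (ler_wpM2l (mulr_ge0 d0 d1) h00) (ler_wpM2l (mulr_ge0 pT0 d1) h10))
     (ler_wpM2l (mulr_ge0 d0 pU0) h01)) (ler_wpM2l (mulr_ge0 pT0 pU0) h11).
  have := ler_wpM2l (mulr_ge0 bT0 bU0) thick.
  move=> t1 t2; apply: le_trans (lerD t2 t1); rewrite le_eqVlt; apply/orP; left; apply/eqP; ring.
apply: ler_sum => Y hY; have /levelP[aY Yy rY] := hY.
have n1 := nullity_ge0 aY; have n2 := nullity_ge0 Yy; have n3 := thickness_ge0 Y ca.
have h0 : bU <= bU + nullity Y y * pU by rewrite lerDl mulr_ge0.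
apply: le_trans (_ : _ <= (bT * (1 + thickness x a Y) + pT * nullity a Y) * (bU + nullity Y y * pU)) _.
  have -> : (bT * (1 + thickness x a Y) + pT * nullity a Y) * (bU + nullity Y y * pU) =
    (bT + pT * nullity a Y) * (bU + nullity Y y * pU) + bT * thickness x a Y * (bU + nullity Y y * pU) by ring.
  by rewrite lerD2l mulrAC ler_wpM2l // mulr_ge0.
have q0 : 0 <= bT * (1 + thickness x a Y) + pT * nullity a Y.
  by rewrite addr_ge0 // mulr_ge0 // addr_ge0.
apply: ler_pM; rewrite ?qP ?hP //.
by rewrite (le_trans _ h0).
Qed.

(** The nullity splits as that of [[a, y]] plus the thickness at a. The first part is matched with
    the expansion of [pencil_h] along a coloop, the second with its expansion along a point of the
    long line; the comparison is then term by term. *)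
Lemma interval_h_ge S x y : (x <= y)%O -> ranks_in S (rho x) (rho y) ->
  boolean_h S (rho x) (rho y) + nullity x y * pencil_h S (rho x) (rho y) <= interval_h S x y.
Proof.
have [n] := ubnP (rho y - rho x); elim: n x y S => // n IH x y S lt xy inS.
have [yx|ne] := eqVneq x y.
  case: S inS => [_|s S /= /and3P[h1 h2 _]]; first by rewrite /= mulr0 addr0.
  by rewrite yx in h1; clear -h1 h2; lia.
have [a ca ay] := exists_rcover xy ne; have /andP[xa /eqP ra] := ca.
have rle := rho_le ay.
have rxy : (rho x < rho y)%N by rewrite -ra.
rewrite (interval_h_terms ca ay inS) (boolean_h_terms rxy inS) (nullityE ca ay) mulrDl.
rewrite {2}(pencil_h_terms rxy inS).
have -> : nullity a y * pencil_h S (rho x) (rho y) = nullity a y *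
    term_sum S (rho x) (fun k T0 U =>
    (bin_m1 (rho y - rho x - 3) (k - rho x))%:Z * boolean_h T0 (rho x) k * boolean_h U k.+1 (rho y)
    + (bin_m2 (rho y - rho x - 3) (k - rho x))%:Z * pencil_h T0 (rho x) k * boolean_h U k.+1 (rho y)
    + 'C(rho y - rho x - 3, k - rho x)%:Z * boolean_h T0 (rho x) k * pencil_h U k.+1 (rho y)).
  case: (ltnP (rho x).+1 (rho y)) => r2; first by rewrite -pencil_h_coloop.
  by rewrite (_ : a = y) ?nullity_xx ?mul0r //; apply: rho_eq; rewrite ?ra.
rewrite /term_sum !mulr_sumr addrA -!big_split /= big_seq [leRHS]big_seq.
apply: ler_sum => t /(terms_spec rxy inS)[xk ky inT inU _].
apply: interval_h_term_ge => //; try exact: pencil_h_bounds.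
  move=> Y /levelP[aY Yy rY].
  have kE : t.1.1 = (rho Y).-1 by rewrite rY.
  have /andP[p0 pb] := pencil_h_bounds inT.
  (* The two cases are mixed with weights boolean minus pencil and pencil. *)
  have w0 := sum_weighted_avoid false ca aY; have w1 := sum_weighted_avoid true ca aY.
  have d0 : 0 <= boolean_h t.1.2 (rho x) t.1.1 - pencil_h t.1.2 (rho x) t.1.1 by rewrite subr_ge0.
  apply: le_trans (le_trans (lerD (ler_wpM2l d0 w0) (ler_wpM2l p0 w1)) _).
    by rewrite le_eqVlt; apply/orP; left; apply/eqP => /=; ring.
  rewrite !mulr_sumr -big_split /= -kE; apply: ler_sum => X /avoidP[xX XY rX aX].
  have := IH x X t.1.2; rewrite rX => H.
  apply: le_trans (H _ xX inT); first by rewrite le_eqVlt; apply/orP; left; apply/eqP => /=; ring.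
  by clear -lt ky rxy; lia.
move=> Y /levelP[aY Yy rY]; have := IH Y y t.2; rewrite rY; apply=> //.
by move: (t.1.1 : nat) xk ky => k xk ky; clear -lt xk ky; lia.
Qed.

End Lattice.

(** * Flag numbers as recursive sums *)

Section FlagVector.
Variables (T : finType) (le : rel T) (rho : T -> nat) (k : nat).
Hypotheses (le_refl : reflexive le) (le_tr : transitive le).
Hypothesis rho_mono : forall x y, le x y -> (rho x <= rho y)%N.
Hypothesis rho_inj : forall x y, le x y -> rho x = rho y -> x = y.
Hypothesis rho_bound : forall x, (rho x < k)%N.
Implicit Types (U S : {set 'I_k}) (C : {set T}).

Definition chains_below U (y : T) : {set {set T}} :=
  [set C | [&& is_chain le C, [forall i : 'I_k, (i \in U) == [exists x in C, rho x == i]]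
    & [forall x in C, le x y]]].

Lemma chains_belowP U y C : reflect
  [/\ {in C &, forall x z, le x z || le z x},
      forall i, i \in U <-> exists2 x, x \in C & rho x = i & {in C, forall x, le x y}]
  (C \in chains_below U y).
Proof.
rewrite inE; apply: (iffP and3P) => -[h1 h2 h3]; split.
- by move=> x z xC zC; have /forall_inP/(_ x xC)/forall_inP/(_ z zC) := h1.
- move=> i; have /forallP/(_ i)/eqP -> := h2.
  by split=> [/exists_inP[x xC /eqP]|[x xC r]]; [exists x | apply/exists_inP; exists x; rewrite // r].
- exact/forall_inP.
- by apply/forall_inP => x xC; apply/forall_inP => z zC; apply: h1.
- apply/forallP => i; apply/eqP; apply/idP/exists_inP => [/h2[x xC r]|[x xC /eqP r]].
    by exists x; rewrite // r.
  by apply/h2; exists x.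
- exact/forall_inP.
Qed.

Lemma rank_in_chain U y C x : C \in chains_below U y -> x \in C ->
  Ordinal (rho_bound x) \in U.
Proof. by move=> /chains_belowP[_ h _] xC; apply/h; exists x. Qed.

(** As s exceeds every rank in [U], an element of rank s must be the top of the chain. *)
Lemma chains_below_setU1 U (s : 'I_k) y z C : {in U, forall i : 'I_k, (i < s)%N} ->
  le z y -> rho z = s ->
  (C \in chains_below U z) = (z \notin C) && (z |: C \in chains_below (s |: U) y).
Proof.
move=> Us zy rz; apply/idP/andP => [hC|[zC /chains_belowP[h1 h2 h3]]].
  have zC : z \notin C.
    by apply/negP => /(rank_in_chain hC)/Us; rewrite /= rz ltnn.
  have /chains_belowP[h1 h2 h3] := hC; split=> //; apply/chains_belowP; split.
  - move=> u v /setU1P[->|uC] /setU1P[->|vC]; rewrite ?le_refl ?(h3 _ uC) ?(h3 _ vC) ?orbT //.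
    exact: h1.
  - move=> i; split.
      case/setU1P=> [->|/h2[x xC r]]; first by exists z; rewrite ?setU11.
      by exists x; rewrite // setU1r.
    case=> x /setU1P[->|xC] r; first by rewrite (_ : i = s) ?setU11 //; apply: val_inj; rewrite /= -r.
    by apply: setU1r; apply/h2; exists x.
  - by move=> x /setU1P[->//|/h3 xz]; apply: le_tr zy.
have sub x : x \in C -> x \in z |: C by move=> ?; rewrite setU1r.
have zz : z \in z |: C by rewrite setU11.
have ltz x : x \in C -> le x z.
  move=> xC; case/orP: (h1 x z (sub x xC) zz) => // zx.
  have : Ordinal (rho_bound x) \in s |: U by apply/h2; exists x; rewrite ?sub.
  have := rho_mono zx; rewrite rz => sx /setU1P[/(congr1 val) /= xs|/Us /=]; last by lia.
  by move: zC; rewrite (rho_inj zx) ?xC // rz xs.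
apply/chains_belowP; split=> //; first by move=> u v uC vC; apply: h1; apply: sub.
move=> i; split=> [iU|[x xC r]].
  have /h2[x /setU1P[->|xC] r] : i \in s |: U by rewrite setU1r.
    by have := Us i iU; rewrite -r rz ltnn.
  by exists x.
have /setU1P[is_|//] : i \in s |: U by apply/h2; exists x; rewrite ?sub.
by move: zC; rewrite -(rho_inj (ltz x xC)) ?xC // r is_ rz.
Qed.

Lemma card_chains_below_setU1 U (s : 'I_k) y : {in U, forall i : 'I_k, (i < s)%N} ->
  #|chains_below (s |: U) y| = \sum_(z | le z y && (rho z == s)) #|chains_below U z|.
Proof.
move=> Us; rewrite -sum1_card.
transitivity (\sum_(z | le z y && (rho z == s)) \sum_(C in chains_below (s |: U) y | z \in C) 1)%N.
  rewrite (exchange_big_dep (mem (chains_below (s |: U) y))) /=; last by move=> z C _ /andP[].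
  apply: eq_bigr => C hC; have /chains_belowP[h1 h2 h3] := hC.
  have /h2[z zC rz] : s \in s |: U by rewrite setU11.
  rewrite hC (big_pred1 z) // => u; apply/idP/eqP => [/andP[/andP[uy /eqP ru] uC]|->].
    by case/orP: (h1 u z uC zC) => [uz|zu]; [apply: rho_inj | apply/esym/rho_inj]; rewrite ?ru.
  by rewrite h3 // rz eqxx.
apply: eq_bigr => z /andP[zy /eqP rz].
rewrite (reindex_onto (fun C => z |: C) (fun C => C :\ z)) /=; last first.
  by move=> C /andP[_ zC]; rewrite setD1K.
rewrite -sum1_card; apply: eq_bigl => C; rewrite (chains_below_setU1 _ Us zy rz) setU11 andbT andbC.
by congr (_ && _); apply/eqP/idP => [<-|/setU1K//]; rewrite setD11.
Qed.

Definition flag_h_below S y : int :=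
  \sum_(U : {set 'I_k} | U \subset S) (-1) ^+ (#|S| - #|U|) * (#|chains_below U y|)%:Z.

(** The subsets containing s give the sum; the others change sign because the ambient set has grown
    by one. *)
Lemma flag_h_below_setU1 S (s : 'I_k) y : {in S, forall i : 'I_k, (i < s)%N} ->
  flag_h_below (s |: S) y =
  \sum_(z | le z y && (rho z == s)) flag_h_below S z - flag_h_below S y.
Proof.
move=> Ss; have sS : s \notin S by apply/negP => /Ss; rewrite ltnn.
rewrite /flag_h_below (bigID (fun U : {set 'I_k} => s \in U)) /=; congr (_ + _).
  rewrite (reindex_onto (fun U => s |: U) (fun U => U :\ s)) /=; last first.
    by move=> U /andP[_ sU]; rewrite setD1K.
  rewrite exchange_big /=.
  apply: eq_big => [U|U].
    rewrite setU11 andbT; apply/andP/idP => [[sub /eqP e]|US].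
      apply/subsetP => i iU; have := subsetP sub i; rewrite setU1r // => /(_ isT) /setU1P[is_|//].
      by move: iU; rewrite -e is_ setD11.
    rewrite setUS // setU1K //; by apply: contra sS; apply: (subsetP US).
  case/andP=> /andP[sub _] /eqP e.
  have sU : s \notin U by rewrite -e setD11.
  have US : U \subset S.
    apply/subsetP => i iU; have := subsetP sub i; rewrite setU1r // => /(_ isT) /setU1P[is_|//].
    by move: sU; rewrite -is_ iU.
  rewrite card_chains_below_setU1; last by move=> i iU; apply: Ss; apply: (subsetP US).
  by rewrite !cardsU1 sS sU -mulr_sumr /= subSS (raddf_sum Posz).
rewrite -sumrN; apply: eq_big => [U|U /andP[sub sU]].
  apply/andP/idP => [[sub sU]|US].
    by apply/subsetP => i iU; have := subsetP sub i iU => /setU1P[is_|//]; move: sU; rewrite -is_ iU.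
  split; first exact: subset_trans US (subsetUr _ _).
  by apply: contra sS; apply: (subsetP US).
have US : U \subset S.
  by apply/subsetP => i iU; have := subsetP sub i iU => /setU1P[is_|//]; move: sU; rewrite -is_ iU.
by rewrite cardsU1 sS add1n subSn ?subset_leq_card // exprS mulN1r mulNr.
Qed.

(** [ranks_in] makes [l] strictly decreasing with entries below [k], so its head is the largest
    rank, as [flag_h_below_setU1] requires. *)
Lemma flag_h_below_seq l x y m : (m <= k)%N -> ranks_in l x m ->
  flag_h_below [set i : 'I_k | val i \in l] y = poset_h le rho predT l y.
Proof.
elim: l y m => [|s l IH] y m mk.
  move=> _ /=; have -> : [set i : 'I_k | val i \in [::]] = set0 by apply/setP => i; rewrite !inE.
  rewrite /flag_h_below (big_pred1 set0) => [|U]; last by rewrite subset0.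
  rewrite subnn expr0 mul1r (_ : chains_below set0 y = [set set0]) ?cards1 //.
  apply/setP => C; rewrite [in RHS]inE; apply/idP/eqP => [hC|->].
    by apply/setP => u; rewrite inE; apply/negP => /(rank_in_chain hC); rewrite inE.
  by apply/chains_belowP; split=> [u|i|u]; rewrite ?inE //; split=> // -[u]; rewrite inE.
move=> /= /and3P[xs sm inl]; have sk := leq_trans sm mk.
have -> : [set i : 'I_k | val i \in s :: l] = Ordinal sk |: [set i : 'I_k | val i \in l].
  by apply/setP => i; rewrite !inE.
rewrite flag_h_below_setU1; last first.
  move=> i; rewrite inE /= => il; have : all (fun u => (u < s)%N) l.
    elim: (l) (s) inl => //= u l' IHl t /and3P[_ ut inl']; rewrite ut /=.
    by apply: sub_all (IHl _ inl') => v /= vu; apply: ltn_trans ut.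
  by move/allP/(_ _ il).
have inl' := ranks_in_widen (ltnW sm) inl.
rewrite (IH y m) //; congr (_ - _); apply: eq_bigr => z _; exact: IH mk inl'.
Qed.

Lemma flag_h_seq l x top : ranks_in l x k -> (forall z, le z top) ->
  flag_h le rho [set i : 'I_k | val i \in l] = poset_h le rho predT l top.
Proof.
move=> inl topP; rewrite -(flag_h_below_seq _ (leqnn k) inl) /flag_h /flag_h_below.
apply: eq_bigr => U _; congr (_ * (Posz _)); rewrite /flag_f; apply: eq_card => C; rewrite !inE.
by rewrite (_ : [forall x in C, le x top] = true) ?andbT //; apply/forall_inP.
Qed.
End FlagVector.

(** Lists a set of positive ranks in the decreasing order that [ranks_in] demands. *)
Fixpoint down (p : pred nat) (m : nat) : seq nat :=
  if m is m'.+1 then if p m then m :: down p m' else down p m' else [::].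

Lemma mem_down p m i : (i \in down p m) = (0 < i <= m)%N && p i.
Proof.
elim: m i => [|m IH] i /=; first by case: i.
have [->|ne] := eqVneq i m.+1.
  case: ifP => pm; first by rewrite inE eqxx leqnn.
  by rewrite IH pm !andbF.
have -> : (i <= m.+1)%N = (i <= m)%N by rewrite leq_eqVlt (negbTE ne) ltnS.
by case: ifP => _; rewrite ?inE ?(negbTE ne) IH.
Qed.

Lemma ranks_in_down p m : ranks_in (down p m) 0 m.+1.
Proof.
elim: m => //= m IH; case: ifP => _ /=; first by rewrite ltnSn IH.
exact: ranks_in_widen (leqnSn _) IH.
Qed.

(** * The near pencil *)

Section NearPencil.
Variables (n r : nat).
Hypotheses (r_gt0 : (0 < r)%N) (lt_rn : (r < n)%N).
Let a := r.-1.
Let b := (n - r).+1.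
Let E := 'I_(np_ground n r).

Definition coloop_part (A : {set E}) : {set 'I_a} := [set i | lshift b i \in A].
Definition line_part (A : {set E}) : {set 'I_b} := [set j | rshift a j \in A].
Definition glue (p : {set 'I_a} * {set 'I_b}) : {set E} :=
  [set e : 'I_(a + b) | match split e with inl i => i \in p.1 | inr j => j \in p.2 end].

Lemma glue_l p i : (lshift b i \in glue p) = (i \in p.1).
Proof. by rewrite inE (unsplitK (inl i)). Qed.

Lemma glue_r p j : (rshift a j \in glue p) = (j \in p.2).
Proof. by rewrite inE (unsplitK (inr j)). Qed.

Lemma coloop_part_glue p : coloop_part (glue p) = p.1.
Proof. by apply/setP => i; rewrite inE glue_l. Qed.

Lemma line_part_glue p : line_part (glue p) = p.2.
Proof. by apply/setP => i; rewrite inE glue_r. Qed.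

Lemma glueK A : glue (coloop_part A, line_part A) = A.
Proof.
apply/setP => e; rewrite inE; have := splitK (e : 'I_(a + b)).
by case: split => i <-; rewrite !inE.
Qed.

Lemma np_rankE A : np_rank A = (#|coloop_part A| + minn 2 #|line_part A|)%N.
Proof. by []. Qed.

Lemma glue_sub p q : (glue p \subset glue q) = (p.1 \subset q.1) && (p.2 \subset q.2).
Proof.
apply/subsetP/andP => [h|[/subsetP h1 /subsetP h2] e].
  by split; apply/subsetP => i; [rewrite -!glue_l | rewrite -!glue_r]; apply: h.
by rewrite !inE; case: split => i; [apply: h1 | apply: h2].
Qed.

Definition line_flat (B : {set 'I_b}) := (#|B| <= 1)%N || (B == setT).

(** A new coloop always raises the rank, and on the line two points already have full rank. *)
Lemma np_flatE A : np_flat A = line_flat (line_part A).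
Proof.
rewrite /line_flat; apply/forall_inP/orP => [h|].
  have [B1|B1] := leqP #|line_part A| 1; [by left | right].
  apply/eqP/setP => j; rewrite [RHS]inE; apply/negPn/negP => jB.
  have := h (rshift a j); rewrite inE in jB; move/(_ jB).
  rewrite !np_rankE (_ : coloop_part (_ |: A) = coloop_part A); last first.
    by apply/setP => i; rewrite !inE eq_lrshift.
  by rewrite ltn_add2l (minn_idPl B1) ltnNge geq_minl.
move=> h e; have := splitK (e : 'I_(a + b)); case: split => i <- /= iA.
  rewrite !np_rankE (_ : line_part (_ |: A) = line_part A); last first.
    by apply/setP => j; rewrite !inE eq_rlshift.
  rewrite ltn_add2r (_ : coloop_part (_ |: A) = i |: coloop_part A).
    by rewrite cardsU1 inE iA.
  by apply/setP => j; rewrite !inE (inj_eq (@lshift_inj _ _)).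
have iB : i \notin line_part A by rewrite inE.
rewrite !np_rankE (_ : coloop_part (_ |: A) = coloop_part A); last first.
  by apply/setP => j; rewrite !inE eq_lrshift.
rewrite ltn_add2l (_ : line_part (_ |: A) = i |: line_part A); last first.
  by apply/setP => j; rewrite !inE (inj_eq (@rshift_inj _ _)).
rewrite cardsU1 iB; case: h => [h|/eqP e']; last by rewrite e' inE in iB.
by move: h; case: #|_| => [|[|]].
Qed.

Lemma np_rank_mono (A B : {set E}) : A \subset B -> (np_rank A <= np_rank B)%N.
Proof.
move=> AB; rewrite !np_rankE.
have /subset_leq_card h1 : coloop_part A \subset coloop_part B.
  by apply/subsetP => i; rewrite !inE; apply: (subsetP AB).
have /subset_leq_card h2 : line_part A \subset line_part B.
  by apply/subsetP => i; rewrite !inE; apply: (subsetP AB).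
by apply: leq_add => //; rewrite leq_min geq_minl (leq_trans (geq_minr _ _)).
Qed.

Lemma np_rho_mono (x y : NearPencil n r) : np_le x y -> (np_rho x <= np_rho y)%N.
Proof. exact: np_rank_mono. Qed.

Lemma np_rho_inj (x y : NearPencil n r) : np_le x y -> np_rho x = np_rho y -> x = y.
Proof.
move=> xy rxy; apply: val_inj; apply/eqP; rewrite eqEsubset; apply/andP; split=> //; apply/subsetP => e ey.
apply/negPn/negP => ex; have /forall_inP/(_ e ex) := valP x.
rewrite ltnNge => /negP; apply; rewrite -/(np_rho x) rxy; apply: np_rank_mono.
by rewrite subUset sub1set ey.
Qed.

Lemma np_rho_bound (x : NearPencil n r) : (np_rho x < r.+2)%N.
Proof.
rewrite /np_rho np_rankE.
have := subset_leq_card (subsetT (coloop_part (val x))); rewrite cardsT card_ord.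
have := geq_minl 2 #|line_part (val x)|.
move=> h1 h2; rewrite ltnS; apply: leq_trans (leq_add h2 h1) _.
by rewrite /a addn2 prednK.
Qed.

Definition long_line (x : NearPencil n r) := line_part (val x) == setT.

(** [t] stands for the rank of the line part; the [bin_m] convention gives 0 when [s < t]. *)
Lemma card_coloop_subsets (A : {set 'I_a}) t s : (t <= 2)%N ->
  #|[set A' : {set 'I_a} | (A' \subset A) && (#|A'| + t == s)%N]| =
  (if t is 0 then 'C(#|A|, s) else if t is 1 then bin_m1 #|A| s else bin_m2 #|A| s)%N.
Proof.
have e u : (forall A' : {set 'I_a}, (#|A'| + t == s)%N = (#|A'| == u)) ->
    #|[set A' : {set 'I_a} | (A' \subset A) && (#|A'| + t == s)%N]| = 'C(#|A|, u).
  by move=> h; rewrite -cards_draws; apply: eq_card => A'; rewrite !inE h.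
have z : (s < t)%N -> #|[set A' : {set 'I_a} | (A' \subset A) && (#|A'| + t == s)%N]| = 0.
  move=> st; apply: eq_card0 => A'; rewrite !inE; apply/negP => /andP[_ /eqP]; lia.
case: t e z => [|[|[|]]] // e z _.
- by apply: e => A'; rewrite addn0.
- by case: s e z => [|s] e z; [apply: z | apply: e => A'; rewrite addn1 eqSS].
- by case: s e z => [|[|s]] e z; [apply: z | apply: z | apply: e => A'; rewrite addn2 !eqSS].
Qed.

(* The three groups of flats below y: no point, one point, or all of the long line. *)
Lemma sum_pencil_flats (y : NearPencil n r) s (u v : int) :
  \sum_(z : NearPencil n r | np_le z y && (np_rho z == s)) (u + (long_line z)%:Z * v) =
  'C(#|coloop_part (val y)|, s)%:Z * u
  + (#|line_part (val y)|)%:Z * ((bin_m1 #|coloop_part (val y)| s)%:Z * u)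
  + (long_line y)%:Z * ((bin_m2 #|coloop_part (val y)| s)%:Z * (u + v)).
Proof.
set A := coloop_part (val y); set B := line_part (val y).
have b2 : (1 < b)%N by rewrite /b; lia.
pose phi (B' : {set 'I_b}) : int := u + (B' == setT)%:Z * v.
transitivity (\sum_(Z : {set E} | np_flat Z && ((Z \subset val y) && (np_rank Z == s))) phi (line_part Z)).
  by rewrite (big_sub_cond (@np_flat n r)).
rewrite (reindex glue) /=; last first.
  by exists (fun Z => (coloop_part Z, line_part Z)) => [p|Z] _; rewrite ?glueK // coloop_part_glue line_part_glue -surjective_pairing.
pose c (A' : {set 'I_a}) (B' : {set 'I_b}) := (A' \subset A) && (#|A'| + minn 2 #|B'| == s)%N.
rewrite (eq_bigl (fun p : {set 'I_a} * {set 'I_b} =>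
    (line_flat p.2 && (p.2 \subset B)) && c p.1 p.2)); last first.
  move=> p; rewrite np_flatE line_part_glue np_rankE coloop_part_glue line_part_glue.
  by rewrite -[val y]glueK glue_sub /= -/A -/B /c; case: (line_flat _); case: (p.1 \subset A); case: (p.2 \subset B).
rewrite big_mkcond (eq_bigr (fun p : {set 'I_a} * {set 'I_b} =>
   if (line_flat p.2 && (p.2 \subset B)) && c p.1 p.2 then phi p.2 else 0)); last first.
  by move=> p _; rewrite line_part_glue.
rewrite -(pair_bigA _ (fun A' B' => if (line_flat B' && (B' \subset B)) && c A' B' then phi B' else 0)) /=.
rewrite exchange_big /=.
pose N t : nat := if t is 0 then 'C(#|A|, s) else if t is 1 then bin_m1 #|A| s else bin_m2 #|A| s.
rewrite (eq_bigr (fun B' => if line_flat B' && (B' \subset B) then (N (minn 2 #|B'|))%:Z * phi B' else 0)); last first.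
  move=> B' _; case: (line_flat B' && (B' \subset B)) => /=; last by rewrite big1.
  rewrite -big_mkcond sumr_const -(mulr_natl (phi B')) natz; congr (Posz _ * _).
  by apply: etrans (card_coloop_subsets A s (geq_minl 2 #|B'|)); apply: eq_card => A'; rewrite [RHS]inE.
rewrite -big_mkcond (bigID (fun B' : {set 'I_b} => #|B'| == 0)) /= -addrA; congr (_ + _).
  rewrite (big_pred1 set0) => [|B']; first by rewrite cards0 /phi (_ : (set0 == setT) = false) ?mul0r ?addr0 //;
    apply/negbTE/eqP => /(congr1 (fun X : {set 'I_b} => #|X|)); rewrite cards0 cardsT card_ord.
  rewrite cards_eq0; apply/idP/idP => [/andP[]//|/eqP ->].
  by rewrite /line_flat cards0 sub0set eqxx.
rewrite (bigID (fun B' : {set 'I_b} => #|B'| == 1%N)) /=; congr (_ + _).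
  rewrite (eq_bigr (fun=> (bin_m1 #|A| s)%:Z * u)) => [|B' /andP[_ /eqP B1]]; last first.
    rewrite B1 /= /phi (_ : (B' == setT) = false) ?mul0r ?addr0 //.
    by apply/negbTE/eqP => e; move: B1; rewrite e cardsT card_ord; lia.
  rewrite (eq_bigl (fun B' => B' \in [set B' : {set 'I_b} | (B' \subset B) && (#|B'| == 1%N)])).
    by rewrite sumr_const cards_draws bin1 -mulr_natl natz.
  move=> B'; by rewrite inE /line_flat; case: (eqVneq #|B'| 1%N) => [->|]; rewrite ?andbF ?andbT.
have full B' : [&& (line_flat B' && (B' \subset B)), #|B'| != 0 & #|B'| != 1%N] = (B' == setT) && (B == setT).
  apply/idP/andP => [/and3P[/andP[/orP[B1|/eqP ->] sub] n0 n1]|[/eqP -> /eqP ->]].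
  - by move: B1 n0 n1; case: #|_| => [|[|]].
  - by split=> //; rewrite -subTset.
  - by rewrite /line_flat eqxx orbT subxx cardsT card_ord; apply/andP; split; [|apply/eqP; lia].
rewrite /long_line -/B (eq_bigl (fun B' => (B' == setT) && (B == setT))) => [|B']; last by rewrite -full andbA.
case: (B == setT); last by rewrite big_pred0 ?mul0r // => B'; rewrite andbF.
rewrite (big_pred1 setT) => [|B']; last by rewrite andbT.
by rewrite cardsT card_ord (minn_idPl b2) /phi eqxx !mul1r.
Qed.

(** Below a flat containing the long line lies a near pencil of nullity b - 2 = n - r - 1; below any
    other flat the interval is Boolean. *)
Lemma np_poset_h l (y : NearPencil n r) :
  poset_h (@np_le n r) (@np_rho n r) predT l y =
  boolean_h l 0 (np_rho y) + (long_line y)%:Z * ((n - r.+1)%:Z * pencil_h l 0 (np_rho y)).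
Proof.
elim: l y => [|s l IH] y /=; first by rewrite !mulr0 addr0.
rewrite (eq_bigr (fun z => boolean_h l 0 s + (long_line z)%:Z * ((n - r.+1)%:Z * pencil_h l 0 s))); last first.
  by move=> z /andP[_ /eqP rz]; rewrite IH rz.
rewrite (eq_bigl (fun z => np_le z y && (np_rho z == s))) //.
rewrite sum_pencil_flats IH !subn0.
have ry : np_rho y = (#|coloop_part (val y)| + minn 2 #|line_part (val y)|)%N by rewrite /np_rho np_rankE.
have b2 : (1 < b)%N by rewrite /b; lia.
have := valP y; rewrite np_flatE /line_flat /long_line.
have [full|nfull] := eqVneq (line_part (val y)) setT => /=.
  move=> _; move: ry; rewrite full cardsT card_ord (minn_idPl b2) => ry; rewrite ry addn2 !subSS subn0.
  have -> : b%:Z = (n - r.+1)%:Z + 2 by rewrite /b; lia.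
  by rewrite !bin_split bin_m1S !PoszD; ring.
rewrite orbF => l1; rewrite !mul0r !addr0; move: ry; case: #|line_part _| l1 => [|[|]] //= _ ry.
  by rewrite ry addn0; ring.
by rewrite ry addn1 bin_split PoszD; ring.
Qed.

Lemma np_flag_h l : ranks_in l 0 r.+2 ->
  flag_h (@np_le n r) (@np_rho n r) [set i : 'I_r.+2 | val i \in l] =
  boolean_h l 0 r.+1 + (n - r.+1)%:Z * pencil_h l 0 r.+1.
Proof.
move=> inl; have b2 : (1 < b)%N by rewrite /b; lia.
have lineT : line_part setT = setT by apply/setP => j; rewrite !inE.
have colT : coloop_part setT = setT by apply/setP => j; rewrite !inE.
have topP : np_flat (setT : {set E}) by rewrite np_flatE lineT /line_flat eqxx orbT.
pose top : NearPencil n r := Sub setT topP.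
have rtop : np_rho top = r.+1.
  by rewrite /np_rho /= np_rankE lineT colT !cardsT !card_ord (minn_idPl b2) /a; lia.
rewrite (@flag_h_seq _ _ _ _ _ _ _ _ _ l 0 top) //.
- by rewrite np_poset_h rtop /long_line /= lineT eqxx mul1r.
- by move=> x; apply: subxx.
- by move=> x y z; apply: subset_trans.
- exact: np_rho_mono.
- exact: np_rho_inj.
- exact: np_rho_bound.
- by move=> z; apply: subsetT.
Qed.
End NearPencil.

(** * Comparison of the lattice with the near pencil *)

Lemma eq_poset_h (T : finType) (le : rel T) rho (D D' : pred T) S y : D =1 D' ->
  poset_h le rho D S y = poset_h le rho D' S y.
Proof.
move=> DD'; elim: S y => //= s S IH y; rewrite IH; congr (_ - _).
by apply: eq_big => [z|z _]; rewrite ?DD' ?IH.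
Qed.

Lemma natoms_atoms (d : Order.disp_t) (T : finTBLatticeType d) (rho : T -> nat) :
  geometric rho -> natoms rho \bot%O \top%O = #|@atoms d T|.
Proof.
move=> geom; have rho0 : rho \bot%O = 0%N by case: geom => -[].
apply: eq_card => e; rewrite [RHS]inE; apply/levelP/idP => [[_ _]|/(rcover_bot geom)/andP[_ /eqP]].
  rewrite rho0 => re; apply/andP; split.
    by rewrite lt0x; apply/eqP => e0; rewrite e0 rho0 in re.
  apply/forallP => z; apply/negP => /andP[/(rho_lt geom) h1 /(rho_lt geom) h2].
  by move: h1 h2; rewrite rho0 re; case: (rho z).
by rewrite le0x lex1.
Qed.

Theorem theorem3p5 (d : Order.disp_t) (T : finTBLatticeType d) (rho : T -> nat)
    (n r : nat) :
  geometric rho ->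
  rho Order.top = r.+1 ->
  #|@atoms d T| = n ->
  (0 < r)%N -> (r.+1 <= n)%N ->
  forall S : {set 'I_r.+2},
    ord0 \notin S -> ord_max \notin S ->
    (flag_h (@np_le n r) (@np_rho n r) S
       <= flag_h (@Order.le d T) rho S)%R.
Proof.
move=> geom rtop natE r0 rn S S0 Smax.
have rho0 : rho Order.bottom = 0%N by case: geom => -[].
(* Ranks 0 and r + 1 are excluded from [S], so this list exhausts it. *)
pose l := down (fun i => inord i \in S) r.
have -> : S = [set i : 'I_r.+2 | val i \in l].
  apply/setP => i; rewrite inE mem_down inord_val.
  case: (boolP (i \in S)) => iS; rewrite ?andbF // andbT; apply/esym/andP; split.
    by rewrite lt0n; apply: contra S0 => /eqP i0; rewrite (_ : ord0 = i) //; apply: val_inj.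
  have := ltn_ord i; rewrite !ltnS leq_eqVlt => /orP[/eqP ir|//].
  by move: Smax; rewrite (_ : ord_max = i) ?iS //; apply: val_inj.
have inl : ranks_in l 0 r.+1 := ranks_in_down _ r.
rewrite np_flag_h //; last exact: ranks_in_widen (leqnSn _) inl.
rewrite (@flag_h_seq _ _ _ _ _ _ _ _ _ l 0 Order.top).
- rewrite (@eq_poset_h _ _ _ _ (fun z => Order.bottom <= z)%O); last by move=> z; rewrite le0x.
  (* The whole lattice has nullity n - (r + 1), the coefficient of [pencil_h] in [np_flag_h]. *)
  have := @interval_h_ge d T rho geom l Order.bottom Order.top (le0x _).
  rewrite rho0 rtop => /(_ inl); rewrite /nullity natoms_atoms // natE rho0 rtop addr0.
  by rewrite -subzn.
- exact: lexx.
- exact: le_trans.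
- by move=> x y; apply: rho_le.
- by move=> x y xy rxy; apply: (rho_eq geom xy); rewrite rxy.
- by move=> x; rewrite ltnS -rtop; apply: rho_le; rewrite ?lex1.
- exact: ranks_in_widen (leqnSn _) inl.
- exact: lex1.
Qed.
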